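(* Let $n\ge1$ and $\alpha:\{0,1\}\to\{0,1\}$. Then $\mathcal{F}_\alpha$ is a bijection from the set of finitely supported sequences $(F_j)_{j\in\mathbb{Z}}$ of contractive $n\times n$ matrices onto the set of (matrix-valued) Laurent polynomials $$M=\begin{pmatrix} A & B \\ C & D \end{pmatrix}:\mathbb{T}\to U(2n)$$ satisfying $A(\infty)\in\mathcal{G}_{\alpha(0)}$ and $D(0)\in\mathcal{G}_{\alpha(1)}$. The same statement holds with $U(2n)$ replaced by $SU(2n)$. Furthermore, if $B$ and $C^*$ are analytic, then the preimage of $M$ under $\mathcal{F}_\alpha$ is the output of the Layer Stripping Algorithm applied to $M$.
   Context: $\mathbb{T}$ is the unit circle. $\mathrm{Id}$ is the identity matrix, ${}^*$ the conjugate transpose (on $\mathbb{T}$). A complex $n\times n$ matrix is contractive if its operator norm is $<1$. $2n\times2n$ matrices are written in $n\times n$ blocks. The conditions $A(\infty)\in\mathcal{G}_{\alpha(0)}$ and $D(0)\in\mathcal{G}_{\alpha(1)}$ include that $A$ is a polynomial in $z^{-1}$ and $D$ is a polynomial in $z$, so that the values $A(\infty)$, $D(0)$ (the constant coefficients) make sense; ''$B$ and $C^*$ analytic'' means that $B$ is a polynomial in $z$ and $C$ is a polynomial in $z^{-1}$. $\mathcal{G}_0$ ($\mathcal{G}_1$) is the group of upper (lower) triangular complex $n\times n$ matrices with positive diagonal entries. For a contractive matrix $F$, $Y_\alpha(F)$ is the unique matrix $\begin{pmatrix} E & F \\ G & H \end{pmatrix}\in SU(2n)$ with upper right block $F$,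 $E\in\mathcal{G}_{\alpha(0)}$, $H\in\mathcal{G}_{\alpha(1)}$. For $z\in\mathbb{T}$ put formally $Z=\begin{pmatrix} z^{1/2}\mathrm{Id} & 0 \\ 0 & z^{-1/2}\mathrm{Id} \end{pmatrix}$, so that $Z^j\begin{pmatrix} E & F \\ G & H \end{pmatrix}Z^{-j}=\begin{pmatrix} E & z^jF \\ z^{-j}G & H \end{pmatrix}$. For a finitely supported sequence $F$ of contractive matrices, $\mathcal{F}_\alpha(F)(z)=\prod_{j\in\mathbb{Z}}Z^jY_\alpha(F_j)Z^{-j}$, product ordered with $j$ increasing from left to right. For a positive definite hermitian matrix $P$ and $a\in\{0,1\}$, $\mathrm{sqrt}_a(P)$ is the unique element of $\mathcal{G}_a$ with $\mathrm{sqrt}_a(P)\,\mathrm{sqrt}_a(P)^*=P$. For a complex $n\times n$ matrix $K$, $$S_\alpha(K)=\begin{pmatrix} \mathrm{sqrt}_{\alpha(0)}[(\mathrm{Id}+KK^* )^{-1}] & K\,\mathrm{sqrt}_{\alpha(1)}[(\mathrm{Id}+K^*K)^{-1}] \\ -K^*\,\mathrm{sqrt}_{\alpha(0)}[(\mathrm{Id}+KK^* )^{-1}] & \mathrm{sqrt}_{\alpha(1)}[(\mathrm{Id}+K^*K)^{-1}] \end{pmatrix}.$$ Layer Stripping Algorithm: given $M$ with $B,C^*$ analytic, set $M_0:=M$ and $F_j:=0$ for $j<0$. For $j=0,1,2,\dots$, writing $M_j=\begin{pmatrix} A_j & B_j \\ C_j & D_j \end{pmatrix}$, let $F_j$ be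 the upper right block of $S_\alpha(B_j(0)D_j(0)^{-1})$ and set $M_{j+1}(z):=Z^{-1}\big[S_\alpha(B_j(0)D_j(0)^{-1})^{-1}M_j(z)\big]Z$. The output is the sequence $(F_j)_{j\in\mathbb{Z}}$. *)

(* Defs.v *)
From HB Require Import structures.
From mathcomp Require Import all_boot all_order all_algebra finmap.
From mathcomp Require Import complex.
From mathcomp Require Import boolp classical_sets functions cardinality reals.

Set Implicit Arguments.
Unset Strict Implicit.
Unset Printing Implicit Defensive.

Import Order.TTheory GRing.Theory Num.Theory.
Local Open Scope classical_set_scope.
Local Open Scope sesquilinear_scope.
Local Open Scope ring_scope.

Section Defs.
Variable R : realType.
Local Notation C := (R[i]).

Definition circle := {z : C | `|z| == 1}.

Definition l2norm (m : nat) (v : 'cV[C]_m) : R :=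
  Num.sqrt (\sum_(i < m) ComplexField.Normc.normc (v i 0) ^+ 2).

Definition opnorm (m : nat) (K : 'M[C]_m) : R :=
  sup [set l2norm (K *m v) | v in [set v : 'cV[C]_m | l2norm v <= 1]].

Definition contractive (m : nat) (K : 'M[C]_m) : Prop := opnorm K < 1.

Definition Ugroup (m : nat) : set 'M[C]_m := [set X | X \is unitarymx].

Definition SUgroup (m : nat) : set 'M[C]_m :=
  [set X | X \is unitarymx /\ \det X = 1].

(* Booleans encode {0, 1}: [false] is 0 (upper triangular), [true] is 1 (lower
   triangular).  [is_trig_mx] means lower triangular, and [0 < x] in [R[i]]
   says that [x] is a positive real. *)
Definition Ggroup (m : nat) (a : bool) : set 'M[C]_m :=
  [set X | is_trig_mx (if a then X else X^T) /\ forall i, 0 < X i i].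

Section Blocks.
Variables (n : nat) (alpha : bool -> bool).

(* Unique for contractive [K]; the default 0 is only used otherwise. *)
Definition Ymx (K : 'M[C]_n) : 'M[C]_(n + n) :=
  xget 0 [set X : 'M[C]_(n + n) |
    [/\ @SUgroup (n + n) X, ursubmx X = K,
        @Ggroup n (alpha false) (ulsubmx X) &
        @Ggroup n (alpha true) (drsubmx X)]].

(* Z^j X Z^-j, written blockwise to avoid z^(1/2). *)
Definition Zconj (z : C) (j : int) (X : 'M[C]_(n + n)) : 'M[C]_(n + n) :=
  block_mx (ulsubmx X) (z ^ j *: ursubmx X)
           (z ^ (- j) *: dlsubmx X) (drsubmx X).

Definition support_seq (F : int -> 'M[C]_n) : set int := [set j | F j != 0].

Definition fin_contractive : set (int -> 'M[C]_n) :=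
  [set F | finite_set (support_seq F) /\ forall j, contractive (F j)].

(* The product over all integers is taken over the support of [F] listed in
   increasing order, the remaining factors being [Ymx 0], i.e. the identity. *)
Definition NLFT (F : int -> 'M[C]_n) (z : circle) : 'M[C]_(n + n) :=
  \big[mulmx/1%:M]_(j <- sort <=%R (enum_fset (fset_set (support_seq F))))
    Zconj (val z) j (Ymx (F j)).

Definition mxeval (m p : nat) (P : 'M[{poly C}]_(m, p)) (w : C) :
  'M[C]_(m, p) := map_mx (horner_eval w) P.

Definition poly_in_z (f : circle -> 'M[C]_n) (P : 'M[{poly C}]_n) : Prop :=
  forall z, f z = mxeval P (val z).

Definition poly_in_zV (f : circle -> 'M[C]_n) (P : 'M[{poly C}]_n) : Prop :=
  forall z, f z = mxeval P (val z)^-1.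

Definition laurent_poly (m : nat) (M : circle -> 'M[C]_m) : Prop :=
  exists (N : nat) (P : 'M[{poly C}]_m),
    forall z, M z = (val z) ^- N *: mxeval P (val z).

(* [mxeval P 0] is the constant coefficient: it is the value at infinity of a
   polynomial [P] in 1/z and the value at 0 of a polynomial [P] in z. *)
Definition NLFT_image (U : set 'M[C]_(n + n)) :
  set (circle -> 'M[C]_(n + n)) :=
  [set M | [/\ laurent_poly M,
    (forall z, U (M z)),
    (exists2 P, poly_in_zV (fun z => ulsubmx (M z)) P &
                @Ggroup n (alpha false) (mxeval P 0)) &
    (exists2 P, poly_in_z (fun z => drsubmx (M z)) P &
                @Ggroup n (alpha true) (mxeval P 0))]].

Definition B_Cstar_analytic (M : circle -> 'M[C]_(n + n)) : Prop :=
  (exists P, poly_in_z (fun z => ursubmx (M z)) P) /\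
  (exists P, poly_in_zV (fun z => dlsubmx (M z)) P).

(* Unique for positive definite hermitian [P]. *)
Definition sqrtmx (a : bool) (P : 'M[C]_n) : 'M[C]_n :=
  xget 0 [set Q : 'M[C]_n | @Ggroup n a Q /\ Q *m Q ^t* = P].

Definition Smx (K : 'M[C]_n) : 'M[C]_(n + n) :=
  let E := sqrtmx (alpha false) (invmx (1%:M + K *m K ^t*)) in
  let H := sqrtmx (alpha true) (invmx (1%:M + K ^t* *m K)) in
  block_mx E (K *m H) (- (K ^t* *m E)) H.

(* [F] is the output of the layer stripping algorithm run on [M].  Every step
   must be meaningful: B_j and D_j are polynomials in z, so that B_j(0) and
   D_j(0) exist, and D_j(0) is invertible. *)
Definition layer_stripping_output
    (M : circle -> 'M[C]_(n + n)) (F : int -> 'M[C]_n) : Prop :=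
  exists Ms : nat -> circle -> 'M[C]_(n + n),
    [/\ Ms 0%N = M,
        (forall j : int, j < 0 -> F j = 0) &
        forall j : nat, exists B D : 'M[{poly C}]_n,
          [/\ poly_in_z (fun z => ursubmx (Ms j z)) B,
              poly_in_z (fun z => drsubmx (Ms j z)) D,
              mxeval D 0 \in unitmx &
              let S := Smx (mxeval B 0 *m invmx (mxeval D 0)) in
              F j%:Z = ursubmx S /\
              forall z, Ms j.+1 z =
                        Zconj (val z) (-1) (invmx S *m Ms j z)]].

End Blocks.
End Defs.

(* Main.v *)
(* Write M = ((A, B), (C, D)) with A, C polynomials in 1/z and B, D polynomials
   in z; shifting the sequence F makes every Laurent polynomial in the image of
   this form.

   A unitary matrix with diagonal blocks E, H in G_0 or G_1 is determined by
   K = F H^-1, and equals S(K).  In a product Y(F_0) Z M' Z^-1, the constant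
   coefficients satisfy B(0) = F_0 D'(0) and D(0) = H_0 D'(0), so that
   B(0) D(0)^-1 = F_0 H_0^-1 recovers Y(F_0): this gives injectivity and the
   correctness of layer stripping.

   Surjectivity: stripping preserves the class of such M, because unitarity
   gives A^* B + C^* D = 0, whose constant coefficient shows that the new lower
   left block is again a polynomial in 1/z.  It terminates: if B, D have degree
   at most N >= 1, the coefficient of z^N in B^* B + D^* D = 1 is
   B(0)^* B_N + D(0)^* D_N = 0, which says exactly that the degree drops.
   When N = 0, stripping leaves B = 0 and D constant, and unitarity together
   with the triangularity of A(oo) and D(0) forces M = 1. *)

Require Import Defs.
From mathcomp Require Import all_boot all_order all_algebra finmap complex.
From mathcomp Require Import boolp classical_sets functions cardinality reals.
From mathcomp Require Import zify.

Set Implicit Arguments.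
Unset Strict Implicit.
Unset Printing Implicit Defensive.

Import Order.TTheory GRing.Theory Num.Theory.
Local Open Scope classical_set_scope.
Local Open Scope sesquilinear_scope.
Local Open Scope ring_scope.

(** * Triangular matrices and Cholesky factorization *)

Section Triangular.
Variable R : realType.
Local Notation C := (R[i]).

Lemma adjmxM m n p (A : 'M[C]_(m, n)) (B : 'M[C]_(n, p)) :
  (A *m B)^t* = B^t* *m A^t*.
Proof. by rewrite trmx_mul map_mxM. Qed.

Lemma adjmxD m n (A B : 'M[C]_(m, n)) : (A + B)^t* = A^t* + B^t*.
Proof. by rewrite linearD /= map_mxD. Qed.

Lemma adjmxN m n (A : 'M[C]_(m, n)) : (- A)^t* = - A^t*.
Proof. by rewrite linearN /= map_mxN. Qed.

Lemma adjmx1 n : (1%:M : 'M[C]_n)^t* = 1%:M.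
Proof. by rewrite trmx1 map_mx1. Qed.

Lemma adjmx0 m n : (0 : 'M[C]_(m, n))^t* = 0.
Proof. by rewrite trmx0 map_mx0. Qed.

Lemma adjmxZ m n (c : C) (A : 'M[C]_(m, n)) : (c *: A)^t* = c^* *: A^t*.
Proof. by rewrite linearZ /= map_mxZ. Qed.

Lemma adjmxV n (A : 'M[C]_n) : (invmx A)^t* = invmx (A^t*).
Proof. by rewrite trmx_inv map_invmx. Qed.

Lemma unitmx_adj n (A : 'M[C]_n) : (A^t* \in unitmx) = (A \in unitmx).
Proof. by rewrite map_unitmx unitmx_tr. Qed.

Lemma adjmx_block m1 m2 n1 n2 (A : 'M[C]_(m1, n1)) B D (E : 'M[C]_(m2, n2)) :
  (block_mx A B D E)^t* = block_mx (A^t*) (D^t*) (B^t*) (E^t*).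
Proof. by rewrite tr_block_mx map_block_mx. Qed.

Lemma trig_mulmx n (X Y : 'M[C]_n) : is_trig_mx X -> is_trig_mx Y ->
  is_trig_mx (X *m Y) /\ forall i, (X *m Y) i i = X i i * Y i i.
Proof.
move=> /is_trig_mxP tX /is_trig_mxP tY; split.
  apply/is_trig_mxP => i j ij; rewrite mxE big1 // => k _.
  case: (ltnP i k) => [ik|ki]; first by rewrite tX // mul0r.
  by rewrite tY ?mulr0 // (leq_ltn_trans ki).
move=> i; rewrite mxE (bigD1 i) //= big1 ?addr0 // => k ki.
case: (ltngtP i k) => [ik|ik|/val_inj ik]; first by rewrite tX // mul0r.
  by rewrite tY ?mulr0.
by rewrite ik eqxx in ki.
Qed.

(** Induction on the block form with corner [x], column [c] and remainder [A]: a right inverse [B]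
    of [A] leads to the lower left block - B c x^-1. As the shape is part of the conclusion,
    [Ggroup_inv] can transfer it to [invmx]. *)
Lemma trig_right_inverse n (X : 'M[C]_n) : is_trig_mx X ->
  (forall i, 0 < X i i) ->
  exists Y : 'M[C]_n,
    [/\ is_trig_mx Y, forall i, 0 < Y i i & X *m Y = 1%:M].
Proof.
move: n X; apply: trigsqmx_ind => [_|n x c A tA IH gt0].
  by exists 0; split; [exact: mx0_is_trig|case|apply/matrixP; case].
have [|B [tB B0 AB]] := IH.
  by move=> i; have := gt0 (rshift 1 i); rewrite block_mxEdr.
have x0 : 0 < x 0 0 by have := gt0 (lshift n 0); rewrite block_mxEul.
have xx : x *m (x 0 0)^-1%:M = 1%:M.
  by rewrite [x]mx11_scalar -scalar_mxM mxE eqxx mulr1n divff // gt_eqF.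
exists (block_mx (x 0 0)^-1%:M 0 (- (B *m c *m (x 0 0)^-1%:M)) B); split.
- by rewrite is_trig_block_mx // eqxx mx11_is_trig.
- move=> i; case: (split_ordP i) => j ->; last by rewrite block_mxEdr.
  by rewrite block_mxEul mxE !ord1 eqxx mulr1n invr_gt0.
rewrite mulmx_block !mul0mx !mulmx0 !addr0 !add0r xx AB mulmxN !mulmxA AB.
by rewrite mul1mx subrr -scalar_mx_block.
Qed.

(** Reduces facts about both groups to the lower triangular case. *)
Lemma GgroupT n a (X : 'M[C]_n) : Ggroup a X -> Ggroup (~~ a) X^T.
Proof. by case: a => -[tX X0]; split => [|i]; rewrite ?trmxK ?mxE. Qed.

Lemma Ggroup_mul n a (X Y : 'M[C]_n) :
  Ggroup a X -> Ggroup a Y -> Ggroup a (X *m Y).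
Proof.
wlog -> : a X Y / a = true => [th|[tX X0] [tY Y0]].
  case: a => GX GY; first exact: th.
  rewrite -[X *m Y]trmxK trmx_mul; apply: (@GgroupT _ true).
  by apply: th => //; exact: (@GgroupT _ false).
have [tXY dXY] := trig_mulmx tX tY.
by split => // i; rewrite dXY mulr_gt0.
Qed.

Lemma Ggroup_unit n a (X : 'M[C]_n) : Ggroup a X -> X \in unitmx.
Proof.
wlog -> : a X / a = true => [th|[tX X0]].
  case: a => GX; first exact: (@th true).
  by rewrite -unitmx_tr; apply: (@th true) => //; exact: (@GgroupT _ false).
by have [Y [_ _ /mulmx1_unit []]] := trig_right_inverse tX X0.
Qed.

Lemma Ggroup_inv n a (X : 'M[C]_n) : Ggroup a X -> Ggroup a (invmx X).
Proof.
wlog -> : a X / a = true => [th GX|GX].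
  case: a GX => GX; first exact: th.
  rewrite -[invmx X]trmxK trmx_inv; apply: (@GgroupT _ true).
  by apply: th => //; exact: (@GgroupT _ false).
have [tX X0] := GX; have [Y [tY Y0 XY]] := trig_right_inverse tX X0.
suff -> : invmx X = Y by [].
by rewrite -[Y](mulKmx (Ggroup_unit GX)) XY mulmx1.
Qed.

Lemma Ggroup_adj n a (X : 'M[C]_n) : Ggroup a X -> Ggroup (~~ a) (X^t*).
Proof.
move=> /GgroupT [tX X0]; split => [|i].
  2: by rewrite mxE (geC0_conj (ltW (X0 i))).
by case: a tX {X0} => /= /is_trig_mxP t; apply/is_trig_mxP => i j ij;
  have := t i j ij; rewrite !mxE => ->; rewrite conjC0.
Qed.

Lemma Ggroup1 n a : Ggroup a (1%:M : 'M[C]_n).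
Proof.
split => [|i]; last by rewrite mxE eqxx.
by case: a; rewrite ?trmx1 scalar_mx_is_trig.
Qed.

(** Here X^-1 = X^* is triangular of both kinds, so X is diagonal, with positive entries of modulus
    one. *)
Lemma Ggroup_unitary n a (X : 'M[C]_n) :
  Ggroup a X -> X *m X^t* = 1%:M -> X = 1%:M.
Proof.
move=> GX XX1; have iX : invmx X = X^t*.
  by rewrite -[X^t*](mulKmx (Ggroup_unit GX)) XX1 mulmx1.
have /Ggroup_adj [] : Ggroup a (X^t*) by rewrite -iX; exact: Ggroup_inv.
rewrite trmxCK => tX' _; have [tX X0] := GX.
have /is_diag_mxP dX : is_diag_mx X.
  rewrite is_diag_mxEtrig.
  by case: a {GX} tX tX' => /= -> ->.
apply/matrixP => i j; rewrite !mxE; case: eqVneq => [<-|ij]; last exact: dX.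
have := congr1 (fun M : 'M[C]_n => M i i) XX1.
rewrite !mxE (bigD1 i) //= big1 => [|k ki]; last first.
  by rewrite dX ?mul0r // eq_sym.
rewrite addr0 eqxx mulr1n !mxE (geC0_conj (ltW (X0 i))) -expr2 => /eqP.
by rewrite sqrp_eq1 ?ltW // => /eqP.
Qed.

Definition posdef n (P : 'M[C]_n) :=
  P^t* = P /\ forall v : 'cV[C]_n, v != 0 -> 0 < (v^t* *m P *m v) 0 0.

Lemma posdef_unit n (P : 'M[C]_n) : posdef P -> P \in unitmx.
Proof.
move=> [_ P0]; rewrite -unitmx_tr -row_free_unit -kermx_eq0.
apply/negPn/negP => /rowV0Pn [v /sub_kermxP vP v0].
have /P0 : v^T != 0 by rewrite -(inj_eq trmx_inj) trmxK trmx0.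
by rewrite -mulmxA -[P *m _]trmxK trmx_mul trmxK vP trmx0 mulmx0 mxE ltxx.
Qed.

Lemma posdef_congr n (P Q : 'M[C]_n) :
  Q \in unitmx -> posdef P -> posdef (Q^t* *m P *m Q).
Proof.
move=> uQ [hP P0]; split; first by rewrite !adjmxM trmxCK hP mulmxA.
move=> v v0; rewrite !mulmxA -adjmxM -mulmxA; apply: P0.
by apply: contraNneq v0 => Qv; rewrite -[v](mulKmx uQ) Qv mulmx0.
Qed.

Lemma posdef_inv n (P : 'M[C]_n) : posdef P -> posdef (invmx P).
Proof.
move=> pP; have uP := posdef_unit pP; have [hP _] := pP.
have := posdef_congr (Q := invmx P) _ pP; rewrite unitmx_inv => /(_ uP).
by rewrite adjmxV hP mulVmx // mul1mx.
Qed.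

Lemma quad_gt0 m (v : 'cV[C]_m) : v != 0 -> 0 < (v^t* *m v) 0 0.
Proof.
move=> v0; rewrite mxE; have h i : true -> 0 <= v^t* 0 i * v i 0.
  by rewrite !mxE mulrC mul_conjC_ge0.
rewrite lt_def sumr_ge0 // andbT psumr_eq0 //.
apply: contraNN v0 => /allP v0; apply/eqP/colP => i.
have := v0 i (mem_index_enum _); rewrite !mxE mulrC mul_conjC_eq0.
by move/eqP.
Qed.

Lemma quad_ge0 m (v : 'cV[C]_m) : 0 <= (v^t* *m v) 0 0.
Proof.
have [->|/quad_gt0/ltW//] := eqVneq v 0; first by rewrite mulmx0 mxE.
Qed.

Lemma posdef_1D n m (K : 'M[C]_(m, n)) : posdef (1%:M + K^t* *m K).
Proof.
split; first by rewrite adjmxD adjmxM adjmx1 trmxCK.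
move=> v v0; rewrite mulmxDr mulmx1 mulmxDl mxE.
rewrite mulmxA -adjmxM -mulmxA ltr_wpDr ?quad_gt0 ?quad_ge0 //.
Qed.

(** Induction by Schur complement: with first pivot [p], the matrix Q - p^-1 u u^* is again positive
    definite. *)
Lemma cholesky n (P : 'M[C]_n) :
  posdef P -> exists2 L : 'M[C]_n, Ggroup true L & L *m L^t* = P.
Proof.
elim: n P => [|n IH] P.
  by exists P; [split; [apply/is_trig_mxP|]; case|apply/matrixP; case].
rewrite -[n.+1]/(1 + n)%N in P *.
move=> [hP P0].
pose p := ulsubmx P 0 0; pose u := dlsubmx P; pose Q := drsubmx P.
have eP : P = block_mx p%:M (u^t*) u Q.
  rewrite -[LHS]submxK -mx11_scalar /u; congr block_mx.
  by rewrite -[in LHS]hP; apply/matrixP => i j; rewrite !mxE.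
have hQ : Q^t* = Q.
  by rewrite /Q -{2}hP; apply/matrixP => i j; rewrite !mxE.
have p0 : 0 < p.
  have /P0 : (col_mx 1%:M 0 : 'cV[C]_(1 + n)) != 0.
    apply/eqP => /(congr1 usubmx); rewrite col_mxKu => /matrixP /(_ 0 0).
    by rewrite !mxE eqxx => /eqP; rewrite oner_eq0.
  rewrite -mulmxA {1}eP mul_block_col !mulmx1 !mulmx0 !addr0 tr_col_mx.
  rewrite map_row_mx mul_row_col trmx0 map_mx0 mul0mx addr0 adjmx1 mul1mx.
  by rewrite mxE eqxx mulr1n.
have pr : p^* = p := geC0_conj (ltW p0).
have /IH [L' GL' eL'] : posdef (Q - p^-1 *: (u *m u^t*)).
  split.
    by rewrite adjmxD adjmxN adjmxZ adjmxM trmxCK hQ fmorphV /= pr.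
  (* This [a] makes the first entry of P applied to [col_mx a w] vanish, so the quadratic form of P
     at this vector is that of the Schur complement at [w]. *)
  move=> w w0; pose a := - (p^-1 *: (u^t* *m w)).
  have /P0 : (col_mx a w : 'cV[C]_(1 + n)) != 0.
    apply: contraNneq w0 => /(congr1 dsubmx); rewrite col_mxKd => ->.
    by apply/eqP/matrixP => i j; rewrite !mxE.
  rewrite -mulmxA {1}eP mul_block_col tr_col_mx map_row_mx mul_row_col.
  have -> : p%:M *m a + u^t* *m w = 0.
    by rewrite /a mulmxN mul_scalar_mx scalerA divff ?gt_eqF // scale1r addNr.
  rewrite mulmx0 add0r /a mulmxN -scalemxAr addrC mulmxA scalemxAl -mulmxBl.
  by rewrite mulmxA.
pose s := sqrtC p.
have s0 : 0 < s by rewrite sqrtC_gt0.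
have sr : s^* = s := geC0_conj (ltW s0).
have ss : s * s = p by rewrite -expr2 sqrtCK.
have [tL' L'0] := GL'.
exists (block_mx s%:M 0 (s^-1 *: u) L').
  split; first by rewrite is_trig_block_mx // eqxx mx11_is_trig.
  move=> i; case: (split_ordP i) => j ->; last by rewrite block_mxEdr.
  by rewrite block_mxEul mxE !ord1 eqxx.
rewrite adjmx_block mulmx_block adjmx0 !mul0mx !mulmx0 !addr0 eL' eP.
rewrite adjmxZ fmorphV /= sr tr_scalar_mx map_scalar_mx /= sr.
congr block_mx.
- by rewrite -scalar_mxM ss.
- by rewrite -scalemxAr mul_scalar_mx scalerA mulVf ?gt_eqF // scale1r.
- by rewrite -scalemxAl mul_mx_scalar scalerA mulVf ?gt_eqF // scale1r.
by rewrite -scalemxAl -scalemxAr scalerA -invfM ss addrC subrK.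
Qed.

(** For the upper triangular root, factor P^-1 = L L^* with L lower triangular and take the adjoint
    of L^-1. *)
Lemma sqrtmx_exists n a (P : 'M[C]_n) :
  posdef P -> exists2 L : 'M[C]_n, Ggroup a L & L *m L^t* = P.
Proof.
case: a => [/cholesky//|pP]; have [L GL eL] := cholesky (posdef_inv pP).
exists ((invmx L)^t*); first exact/(@Ggroup_adj _ true)/Ggroup_inv.
have uL := Ggroup_unit GL; have uLa : L^t* \in unitmx by rewrite unitmx_adj.
have uiP : invmx P \in unitmx by rewrite unitmx_inv posdef_unit.
apply: (can_inj (mulKmx uiP)); rewrite mulVmx ?posdef_unit // -eL trmxCK adjmxV.
by rewrite mulmxA mulmxK // mulmxV.
Qed.

(** The quotient L'^-1 L is unitary and lies in the group, hence equals 1. *)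
Lemma sqrtmx_inj n a (L L' : 'M[C]_n) :
  Ggroup a L -> Ggroup a L' -> L *m L^t* = L' *m L'^t* -> L = L'.
Proof.
move=> GL GL' eL; have uL := Ggroup_unit GL; have uL' := Ggroup_unit GL'.
have /Ggroup_unitary : Ggroup a (invmx L' *m L).
  exact: Ggroup_mul (Ggroup_inv GL') GL.
rewrite adjmxM adjmxV mulmxA -[_ *m L *m _]mulmxA eL mulmxA mulVmx // mul1mx.
rewrite mulmxV ?unitmx_adj // => /(_ erefl) LL.
by rewrite -[LHS](mulKVmx uL') LL mulmx1.
Qed.

Lemma sqrtmxP n a (P : 'M[C]_n) : posdef P ->
  Ggroup a (sqrtmx a P) /\ sqrtmx a P *m (sqrtmx a P)^t* = P.
Proof.
by move=> /(sqrtmx_exists a) [L GL eL]; 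
apply: (@xgetPex _ 0 [set Q : 'M[C]_n | Ggroup a Q /\ Q *m Q^t* = P]); exists L.
Qed.

Lemma sqrtmx_eq n a (L : 'M[C]_n) :
  Ggroup a L -> posdef (L *m L^t*) -> sqrtmx a (L *m L^t*) = L.
Proof.
by move=> GL /(sqrtmxP a) [GS eS]; apply: sqrtmx_inj GS GL eS.
Qed.
End Triangular.

(** * Contractive matrices and squared Euclidean norms *)

Section Contractive.
Variable R : realType.
Local Notation C := (R[i]).
Local Notation normc := (@ComplexField.Normc.normc R).

Definition sqnorm m (v : 'cV[C]_m) : R := \sum_(i < m) normc (v i 0) ^+ 2.

Lemma sqnorm_ge0 m (v : 'cV[C]_m) : 0 <= sqnorm v.
Proof. by apply: sumr_ge0 => i _; exact: sqr_ge0. Qed.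

Lemma quad_sqnorm m (v : 'cV[C]_m) : (v^t* *m v) 0 0 = (sqnorm v)%:C%C.
Proof.
rewrite mxE /sqnorm rmorph_sum; apply: eq_bigr => i _.
by rewrite !mxE mulrC -normCK rmorphXn.
Qed.

Lemma sqnorm_gt0 m (v : 'cV[C]_m) : (0 < sqnorm v) = (v != 0).
Proof.
rewrite -ltcR -quad_sqnorm; apply/idP/idP; last exact: quad_gt0.
by apply: contraTneq => ->; rewrite mulmx0 mxE ltxx.
Qed.

Lemma normc_ge0 (x : C) : 0 <= normc x.
Proof. by case: x => a b; exact: sqrtr_ge0. Qed.

Lemma normc_sum_le I (r : seq I) (F : I -> C) :
  normc (\sum_(i <- r) F i) <= \sum_(i <- r) normc (F i).
Proof.
elim/big_rec2: _ => [|i y x _ h]; first by rewrite ComplexField.Normc.normc0.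
apply: le_trans (lerD (lexx _) h).
by rewrite -lecR rmorphD /=; exact: (@ler_normD _ R[i]).
Qed.

(** A crude bound suffices: it shows that the supremum in [opnorm] is over a bounded set and,
    applied to an inverse, bounds a vector by its image. *)
Lemma sqnorm_mulmx_le m (A : 'M[C]_m) :
  exists2 c : R, 0 < c & forall v : 'cV[C]_m, sqnorm (A *m v) <= c * sqnorm v.
Proof.
pose c := \sum_i (\sum_j normc (A i j)) ^+ 2.
have c0 : 0 <= c by apply: sumr_ge0 => i _; exact: sqr_ge0.
exists (c + 1) => [|v]; first by rewrite ltr_wpDl.
have vj j : normc (v j 0) <= Num.sqrt (sqnorm v).
  rewrite -[leLHS]ger0_norm ?normc_ge0 // -sqrtr_sqr ler_wsqrtr //.
  by rewrite /sqnorm (bigD1 j) //= lerDl sumr_ge0 // => i _; exact: sqr_ge0.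
rewrite mulrDl mul1r ler_wpDr ?sqnorm_ge0 // mulr_suml; apply: ler_sum => i _.
rewrite -[in leRHS](sqr_sqrtr (sqnorm_ge0 v)) -exprMn.
rewrite ler_sqr ?nnegrE ?normc_ge0 ?mulr_ge0 ?sqrtr_ge0 //; last first.
  by apply: sumr_ge0 => j _; exact: normc_ge0.
rewrite mxE; apply: le_trans (normc_sum_le _ _) _; rewrite mulr_suml.
apply: ler_sum => j _; rewrite ComplexField.Normc.normcM.
by rewrite ler_wpM2l ?normc_ge0.
Qed.

Lemma sqnormZ m (a : R) (v : 'cV[C]_m) :
  sqnorm (a%:C%C *: v) = a ^+ 2 * sqnorm v.
Proof.
rewrite /sqnorm mulr_sumr; apply: eq_bigr => i _.
rewrite mxE ComplexField.Normc.normcM exprMn; congr (_ * _).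
by rewrite /= expr0n addr0 sqr_sqrtr ?sqr_ge0.
Qed.

Lemma l2normE m (v : 'cV[C]_m) : l2norm v = Num.sqrt (sqnorm v).
Proof. by []. Qed.

Lemma has_ubound_opnorm m (K : 'M[C]_m) : has_ubound
  [set l2norm (K *m v) | v in [set v : 'cV[C]_m | l2norm v <= 1]].
Proof.
have [c c0 Kc] := sqnorm_mulmx_le K.
exists (Num.sqrt c) => _ [v /= v1 <-]; rewrite l2normE ler_wsqrtr //.
apply: le_trans (Kc v) _; rewrite ger_pMr //.
by move: v1; rewrite l2normE -{1}sqrtr1 ler_sqrt.
Qed.

(** Rescaling [v] to norm one brings it into the unit ball over which [opnorm K] is the supremum. *)
Lemma contractive_posdef m (K : 'M[C]_m) :
  contractive K -> posdef (1%:M - K^t* *m K).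
Proof.
move=> K1; split; first by rewrite adjmxD adjmxN adjmxM adjmx1 trmxCK.
move=> v v0; rewrite mulmxBr mulmxBl mulmx1 mxE [X in _ + X]mxE.
rewrite mulmxA -adjmxM -mulmxA !quad_sqnorm -rmorphB /= ltcR subr_gt0.
have n0 : 0 < sqnorm v by rewrite sqnorm_gt0.
pose l := Num.sqrt (sqnorm v).
have l0 : 0 < l by rewrite sqrtr_gt0.
have ll : l ^+ 2 = sqnorm v by rewrite sqr_sqrtr // ltW.
have : l2norm (K *m (l^-1%:C%C *: v)) < 1.
  apply: le_lt_trans K1; apply: ub_le_sup; first exact: has_ubound_opnorm.
  exists (l^-1%:C%C *: v) => //=.
  by rewrite l2normE sqnormZ exprVn ll mulVf ?gt_eqF // sqrtr1.
rewrite l2normE -scalemxAr sqnormZ exprVn ll -{1}sqrtr1 ltr_sqrt ?ltr01 //.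
by rewrite mulrC ltr_pdivrMr // mul1r.
Qed.

(** The identity says |Fv|^2 + |Hv|^2 = |v|^2, and invertibility of H gives |v|^2 <= c |Hv|^2. Hence
    |Fv|^2 <= (1 - 1/c) |v|^2 uniformly in v, which keeps the supremum itself below 1. *)
Lemma contractive_of_unit m (F H : 'M[C]_m) :
  F^t* *m F + H^t* *m H = 1%:M -> H \in unitmx -> contractive F.
Proof.
move=> FH uH; have [c c0 Hc] := sqnorm_mulmx_le (invmx H).
have FHn v : sqnorm (F *m v) + sqnorm (H *m v) = sqnorm v.
  have := congr1 (fun M => (v^t* *m M *m v) 0 0) FH.
  rewrite mulmxDr mulmxDl mulmx1 quad_sqnorm mxE !mulmxA -!adjmxM.
  by rewrite -!(mulmxA _ _ v) !quad_sqnorm -rmorphD /= => /complexI.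
have vH v : sqnorm v <= c * sqnorm (H *m v).
  by rewrite -[in leLHS](mulKmx uH v); exact: Hc.
have Fv v : sqnorm (F *m v) <= (1 - c^-1) * sqnorm v.
  rewrite -(FHn v) [leRHS](_ : _ = sqnorm (F *m v) + 
    (sqnorm (H *m v) - c^-1 * sqnorm v)); last first.
    by rewrite -[in RHS](FHn v) mulrBl mul1r addrA.
  by rewrite lerDl subr_ge0 mulrC ler_pdivrMr // mulrC.
rewrite /contractive /opnorm.
apply: (@le_lt_trans _ _ (Num.sqrt (1 - c^-1))); last first.
  by rewrite -{2}sqrtr1 ltr_sqrt ?ltr01 // ltrBlDr ltrDl invr_gt0.
apply: ge_sup.
  exists (l2norm (F *m 0)); exists 0 => //=; rewrite l2normE.
  have -> : sqnorm (0 : 'cV[C]_m) = 0; last by rewrite sqrtr0.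
  by apply/eqP; rewrite eq_le sqnorm_ge0 andbT leNgt sqnorm_gt0 eqxx.
move=> _ [v /= v1 <-]; rewrite l2normE.
have {}v1 : sqnorm v <= 1 by move: v1; rewrite l2normE -{1}sqrtr1 ler_sqrt.
have [c1|c1] := leP 0 (1 - c^-1).
  by rewrite ler_wsqrtr // (le_trans (Fv v)) // ler_piMr.
(* With 1 - 1/c negative, the bound leaves only F v = 0. *)
suff -> : sqnorm (F *m v) = 0 by rewrite sqrtr0 sqrtr_ge0.
apply/eqP; rewrite eq_le sqnorm_ge0 andbT (le_trans (Fv v)) //.
by rewrite mulr_le0_ge0 ?sqnorm_ge0 // ltW.
Qed.
End Contractive.

(** * The parametrizations Y and S *)

Section Parametrization.
Variables (R : realType) (n : nat) (alpha : bool -> bool).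
Local Notation C := (R[i]).
Implicit Types (E F G H K : 'M[C]_n) (X : 'M[C]_(n + n)).

Lemma unitary_block E F G H : block_mx E F G H \is unitarymx <->
  [/\ E *m E^t* + F *m F^t* = 1%:M, E *m G^t* + F *m H^t* = 0,
      G *m E^t* + H *m F^t* = 0 & G *m G^t* + H *m H^t* = 1%:M].
Proof.
split=> [/unitarymxP|[h1 h2 h3 h4]].
  by rewrite adjmx_block mulmx_block scalar_mx_block => /eq_block_mx.
apply/unitarymxP.
by rewrite adjmx_block mulmx_block scalar_mx_block h1 h2 h3 h4.
Qed.

Lemma unitary_block_adj E F G H : block_mx E F G H \is unitarymx ->
  [/\ E^t* *m E + G^t* *m G = 1%:M, E^t* *m F + G^t* *m H = 0,
      F^t* *m E + H^t* *m G = 0 & F^t* *m F + H^t* *m H = 1%:M].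
Proof.
by rewrite -trmxC_unitary adjmx_block => /unitary_block; rewrite !trmxCK.
Qed.

Lemma posdef_1Dadj K : posdef (1%:M + K *m K^t*).
Proof. by have := posdef_1D (K^t*); rewrite trmxCK. Qed.

Lemma Smx_blocks K : [/\ Smx alpha K \is unitarymx,
  Ggroup (alpha false) (ulsubmx (Smx alpha K)) &
  Ggroup (alpha true) (drsubmx (Smx alpha K))].
Proof.
have pE := posdef_inv (posdef_1Dadj K); have pH := posdef_inv (posdef_1D K).
have [GE EE] := sqrtmxP (alpha false) pE.
have [GH HH] := sqrtmxP (alpha true) pH.
split; rewrite ?block_mxKul ?block_mxKdr //.
have uE := posdef_unit (posdef_1Dadj K); have uH := posdef_unit (posdef_1D K).
rewrite /Smx; move: (sqrtmx (alpha false) _) EE {GE} => E EE.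
move: (sqrtmx (alpha true) _) HH {GH} => H HH.
(* K intertwines the inverses of 1 + K^* K and 1 + K K^*; this is what makes the off-diagonal blocks
   of S S^* cancel. *)
have KP : K *m (H *m H^t*) = E *m E^t* *m K.
  apply: (can_inj (mulKmx uE)); rewrite EE HH mulKVmx // mulmxA.
  have -> : (1%:M + K *m K^t*) *m K = K *m (1%:M + K^t* *m K).
    by rewrite mulmxDl mulmxDr mul1mx mulmx1 mulmxA.
  by rewrite mulmxK.
have PK : H *m H^t* *m K^t* = K^t* *m (E *m E^t*).
  by have := congr1 (fun M => M^t*) KP; rewrite !adjmxM !trmxCK.
apply/unitary_block.
split; rewrite ?adjmxN ?adjmxM ?trmxCK ?mulmxN ?mulNmx ?opprK.
- rewrite -(mulmxA K H) (mulmxA H) PK -[X in X + _]mul1mx.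
  by rewrite (mulmxA K) -mulmxDl EE mulmxV.
- by rewrite -(mulmxA K) KP mulmxA addNr.
- by rewrite mulmxA PK mulmxA addNr.
rewrite -(mulmxA _ E) (mulmxA E) -KP mulmxA -[X in _ + X]mul1mx -mulmxDl HH.
by rewrite addrC mulmxV.
Qed.

(** The hypothesis reads H^* (1 + K^* K) H = 1, and the outer factors can be moved to the other
    side. *)
Lemma invmx_1D K H : H \in unitmx ->
  (K *m H)^t* *m (K *m H) + H^t* *m H = 1%:M ->
  invmx (1%:M + K^t* *m K) = H *m H^t*.
Proof.
move=> uH h; have uHa : H^t* \in unitmx by rewrite unitmx_adj.
have e : (1%:M + K^t* *m K) *m (H *m H^t*) = 1%:M.
  apply: (can_inj (mulKmx uHa)).
  rewrite (mulmxA (H^t*)) mulmxDr !mulmx1 mulmxDl addrC.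
  rewrite !mulmxA -adjmxM -(mulmxA _ K H) -mulmxDl h.
  by rewrite mul1mx.
by rewrite -[RHS](mulKmx (posdef_unit (posdef_1D K))) e mulmx1.
Qed.

(** Orthogonality of the block columns yields K^* = - G E^-1 for K = F H^-1. By [invmx_1D], applied
    to K with H and to K^* with E, the diagonal blocks are then the triangular roots occurring in
    [Smx]. *)
Lemma Smx_recover X : X \is unitarymx ->
  Ggroup (alpha false) (ulsubmx X) -> Ggroup (alpha true) (drsubmx X) ->
  Smx alpha (ursubmx X *m invmx (drsubmx X)) = X.
Proof.
rewrite -[X]submxK block_mxKul block_mxKdr block_mxKur.
move: (ulsubmx X) (ursubmx X) (dlsubmx X) (drsubmx X) => E F G H UX GE GH.
have uE := Ggroup_unit GE; have uH := Ggroup_unit GH.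
have uEa : E^t* \in unitmx by rewrite unitmx_adj.
have uHa : H^t* \in unitmx by rewrite unitmx_adj.
have [h1 h2 h3 h4] := unitary_block_adj UX.
set K := F *m invmx H.
have KH : K *m H = F by rewrite mulmxKV.
have Ka : K^t* = - (G *m invmx E).
  have -> : G *m invmx E = - (invmx (H^t*) *m F^t*).
    rewrite -[G](mulKmx uHa) -(addKr (F^t* *m E) (H^t* *m G)) h3 addr0.
    by rewrite mulmxN mulNmx mulmxA mulmxK.
  by rewrite opprK adjmxM adjmxV.
have KE : K^t* *m E = - G by rewrite Ka mulNmx mulmxKV.
clearbody K.
have HH : invmx (1%:M + K^t* *m K) = H *m H^t* by apply: invmx_1D; rewrite ?KH.
have EE : invmx (1%:M + K *m K^t*) = E *m E^t*.
  rewrite -{1}[K]trmxCK; apply: invmx_1D => //.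
  by rewrite KE adjmxN mulmxN mulNmx opprK addrC.
have pE := posdef_inv (posdef_1Dadj K); have pH := posdef_inv (posdef_1D K).
have sE : sqrtmx (alpha false) (E *m E^t*) = E.
  by apply: sqrtmx_eq; [exact: GE|rewrite -EE; exact: pE].
have sH : sqrtmx (alpha true) (H *m H^t*) = H.
  by apply: sqrtmx_eq; [exact: GH|rewrite -HH; exact: pH].
by rewrite /Smx EE HH sE sH KH KE opprK.
Qed.

Lemma det_Ggroup_gt0 m a (E : 'M[C]_m) : Ggroup a E -> 0 < \det E.
Proof.
wlog -> : a E / a = true => [th|[tE E0]].
  case: a => GE; first exact: (@th true).
  by rewrite -det_tr; apply: (@th true) => //; exact: (@GgroupT _ _ false).
by rewrite det_trig // prodr_gt0.
Qed.

Lemma det_adjmx m (E : 'M[C]_m) : \det (E^t*) = (\det E)^*.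
Proof. by rewrite det_map_mx det_tr. Qed.

(* The first block column of [X *m X^t* = 1] gives
   [X *m block_mx E^t* 0 F^t* 1 = block_mx 1 F 0 H]. *)
Lemma det_unitary_Ggroup a b E F G H : block_mx E F G H \is unitarymx ->
  Ggroup a E -> Ggroup b H -> \det (block_mx E F G H) = 1.
Proof.
move=> UX GE GH; have [h1 h2 h3 h4] := (unitary_block E F G H).1 UX.
have : block_mx E F G H *m block_mx (E^t*) 0 (F^t*) 1%:M = block_mx 1%:M F 0 H.
  by rewrite mulmx_block !mulmx0 !mulmx1 !add0r h1 h3.
move=> /(congr1 determinant); rewrite det_mulmx det_lblock det_ublock !det1.
rewrite mulr1 mul1r det_adjmx => e.
have dE := det_Ggroup_gt0 GE; have dH := det_Ggroup_gt0 GH.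
have dX : 0 < \det (block_mx E F G H).
  by move: dH; rewrite -e (geC0_conj (ltW dE)) pmulr_lgt0.
have := congr1 determinant (unitarymxP UX); rewrite det_mulmx det_adjmx det1.
rewrite (geC0_conj (ltW dX)) -expr2 => /eqP.
by rewrite sqrp_eq1 ?ltW // => /eqP.
Qed.

(** The determinant condition in [Ymx] holds by [det_unitary_Ggroup]. For uniqueness, F fixes H^* H
    = 1 - F^* F, hence H, and then F H^-1 fixes the whole matrix by [Smx_recover]. *)
Lemma Ymx_eq X : X \is unitarymx ->
  Ggroup (alpha false) (ulsubmx X) -> Ggroup (alpha true) (drsubmx X) ->
  Ymx alpha (ursubmx X) = X.
Proof.
move=> UX GE GH.
have dX (Z : 'M[C]_(n + n)) :
    Z \is unitarymx -> Ggroup (alpha false) (ulsubmx Z) ->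
    Ggroup (alpha true) (drsubmx Z) -> SUgroup Z.
  move=> UZ GE' GH'; split => //; move: UZ; rewrite -[Z]submxK => UZ.
  exact: det_unitary_Ggroup UZ GE' GH'.
apply: xget_unique => [|Z [[UZ _] FZ GEZ GHZ]].
  by split => //; exact: dX.
have : drsubmx Z = drsubmx X.
  have hh (W : 'M[C]_(n + n)) : W \is unitarymx ->
      (drsubmx W)^t* *m drsubmx W = 1%:M - (ursubmx W)^t* *m ursubmx W.
    rewrite -{1}[W]submxK => /unitary_block_adj [_ _ _ <-].
    by rewrite addrC addKr.
  rewrite -[LHS]trmxCK -[RHS]trmxCK.
  (* [sqrtmx_inj] concerns products L L^*, so it is applied to L = H^*, which lies in the opposite
     triangular group. *)
  have -> // : (drsubmx Z)^t* = (drsubmx X)^t*.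
  apply: (@sqrtmx_inj _ _ (~~ alpha true)); first exact: Ggroup_adj.
    exact: Ggroup_adj.
  by rewrite !trmxCK (hh Z UZ) (hh X UX) FZ.
move=> e; have := Smx_recover UX GE GH.
by rewrite -FZ -e (Smx_recover UZ GEZ GHZ).
Qed.

Lemma ursubmx_contractive X : X \is unitarymx ->
  drsubmx X \in unitmx -> contractive (ursubmx X).
Proof.
rewrite -{1}[X]submxK => /unitary_block_adj [_ _ _ h4].
exact: contractive_of_unit h4.
Qed.

(** With H^* a triangular root of 1 - F^* F, the matrix [Smx] of F H^-1 has lower right block H and
    therefore upper right block F. *)
Lemma YmxP F : contractive F ->
  [/\ Ymx alpha F \is unitarymx, ursubmx (Ymx alpha F) = F,
      Ggroup (alpha false) (ulsubmx (Ymx alpha F)) &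
      Ggroup (alpha true) (drsubmx (Ymx alpha F))].
Proof.
move=> /contractive_posdef /(sqrtmx_exists (~~ alpha true)) [L GL eL].
pose H := L^t*; have GH : Ggroup (alpha true) H.
  by rewrite -[alpha true]negbK; exact: Ggroup_adj.
have uH := Ggroup_unit GH.
pose K := F *m invmx H.
have [UX GE GD] := Smx_blocks K.
suff uF : ursubmx (Smx alpha K) = F.
  by rewrite -{-3}uF (Ymx_eq UX) //.
rewrite block_mxKur.
suff -> : sqrtmx (alpha true) (invmx (1%:M + K^t* *m K)) = H.
  by rewrite mulmxKV.
have HH : invmx (1%:M + K^t* *m K) = H *m H^t*.
  by apply: invmx_1D => //; rewrite mulmxKV // trmxCK eL addrC subrK.
rewrite HH; apply: sqrtmx_eq; first exact: GH.
by rewrite -HH; exact: posdef_inv (posdef_1D K).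
Qed.

Lemma det_Ymx F : contractive F -> \det (Ymx alpha F) = 1.
Proof.
move=> /YmxP [UX _ GE GH]; move: UX; rewrite -[Ymx alpha F]submxK => UX.
exact: det_unitary_Ggroup UX GE GH.
Qed.

Lemma contractive0 : contractive (0 : 'M[C]_n).
Proof.
apply: (@contractive_of_unit _ _ _ 1%:M); rewrite ?unitmx1 //.
by rewrite mulmx0 add0r adjmx1 mulmx1.
Qed.

Lemma Ymx0 : Ymx alpha (0 : 'M[C]_n) = 1%:M.
Proof.
have -> : (0 : 'M[C]_n) = ursubmx (1%:M : 'M[C]_(n + n)).
  by rewrite scalar_mx_block block_mxKur.
apply: Ymx_eq; rewrite ?scalar_mx_block ?block_mxKul ?block_mxKdr;
  try exact: Ggroup1.
by rewrite -scalar_mx_block; apply/unitarymxP; rewrite adjmx1 mulmx1.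
Qed.
End Parametrization.

(** * Polynomial matrices on the circle *)

Section PolyMatrices.
Variable R : realType.
Local Notation C := (R[i]).

Lemma circle_neq0 (z : circle R) : val z != 0.
Proof. by rewrite -normr_eq0 (eqP (valP z)) oner_eq0. Qed.

Lemma circle_conj (z : circle R) : (val z)^* = (val z)^-1.
Proof.
apply: (mulfI (circle_neq0 z)).
by rewrite -normCK (eqP (valP z)) expr1n divff ?circle_neq0.
Qed.

Lemma circleV_subproof (z : circle R) : `|(val z)^-1| == 1.
Proof. by rewrite normfV (eqP (valP z)) invr1. Qed.

Definition circleV (z : circle R) : circle R :=
  exist _ (val z)^-1 (circleV_subproof z).

Lemma circle_point_subproof (k : nat) :
  `|(k.+1%:R^-1 +i* Num.sqrt (1 - k.+1%:R^-1 ^+ 2))%C : C| == 1.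
Proof.
rewrite normc_def /= sqr_sqrtr ?subrKC ?sqrtr1 // subr_ge0.
by rewrite exprn_ile1 ?invr_ge0 ?ler0n // invf_le1 ?ltr0n // ler1n.
Qed.

(** The distinct real parts 1/(k+1) give infinitely many points of the circle, as the identity
    theorem for polynomials requires. *)
Definition circle_point (k : nat) : circle R :=
  exist _ (_ +i* _)%C (circle_point_subproof k).

Lemma circle_point_inj : injective (fun k => val (circle_point k)).
Proof.
move=> j k /= [/invr_inj/eqP + _]; rewrite eqr_nat => /eqP [].
exact.
Qed.

(** A nonzero difference would have as many distinct roots as its size, one more than its degree. *)
Lemma poly_circle_eq (p q : {poly C}) :
  (forall z : circle R, p.[val z] = q.[val z]) -> p = q.
Proof.
move=> pq; apply/eqP; rewrite -subr_eq0; apply/negPn/negP => pq0.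
pose rs := map (fun k => val (circle_point k)) (iota 0 (size (p - q))).
have urs : uniq rs.
  by rewrite map_inj_uniq ?iota_uniq //; exact: circle_point_inj.
have rrs : all (root (p - q)) rs.
  by apply/allP => _ /mapP [k _ ->]; rewrite /root hornerD hornerN pq subrr.
by have := max_poly_roots pq0 rrs urs; rewrite size_map size_iota ltnn.
Qed.

Lemma mxeval_inj m p (P Q : 'M[{poly C}]_(m, p)) :
  (forall z : circle R, mxeval P (val z) = mxeval Q (val z)) -> P = Q.
Proof.
move=> PQ; apply/matrixP => i j; apply: poly_circle_eq => z.
by have /matrixP/(_ i j) := PQ z; rewrite !mxE.
Qed.

Definition mxcst m p (A : 'M[C]_(m, p)) : 'M[{poly C}]_(m, p) := map_mx polyC A.

Lemma mxevalM m p q (P : 'M[{poly C}]_(m, p)) (Q : 'M[{poly C}]_(p, q)) w :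
  mxeval (P *m Q) w = mxeval P w *m mxeval Q w.
Proof. exact: map_mxM. Qed.

Lemma mxevalD m p (P Q : 'M[{poly C}]_(m, p)) w :
  mxeval (P + Q) w = mxeval P w + mxeval Q w.
Proof. exact: map_mxD. Qed.

Lemma mxevalZ m p (c : {poly C}) (P : 'M[{poly C}]_(m, p)) w :
  mxeval (c *: P) w = c.[w] *: mxeval P w.
Proof. exact: map_mxZ. Qed.

Lemma mxeval0 m p w : mxeval (0 : 'M[{poly C}]_(m, p)) w = 0.
Proof. exact: map_mx0. Qed.

Lemma mxeval_cst m p (A : 'M[C]_(m, p)) w : mxeval (mxcst A) w = A.
Proof. by apply/matrixP => i j; rewrite !mxE /horner_eval hornerC. Qed.

Lemma mxeval_cstM m p q (A : 'M[C]_(m, p)) (P : 'M[{poly C}]_(p, q)) w :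
  mxeval (mxcst A *m P) w = A *m mxeval P w.
Proof. by rewrite mxevalM mxeval_cst. Qed.

(** Only the coefficients are conjugated. Conjugation inverts points of the circle, so the value at
    such a z is the adjoint of P(1/z): the adjoint of a polynomial in 1/z becomes a polynomial in
    z. *)
Definition mxadj m p (P : 'M[{poly C}]_(m, p)) : 'M[{poly C}]_(p, m) :=
  map_mx (map_poly Num.conj) P^T.

Lemma mxeval_adj m p (P : 'M[{poly C}]_(m, p)) w :
  mxeval (mxadj P) w = (mxeval P (w^*))^t*.
Proof.
apply/matrixP => i j; rewrite !mxE /horner_eval -horner_map /=.
by rewrite conjCK.
Qed.

Definition coefmx m p (k : nat) (P : 'M[{poly C}]_(m, p)) : 'M[C]_(m, p) :=
  map_mx (coefp k) P.

Lemma coefmx0 m p (P : 'M[{poly C}]_(m, p)) : coefmx 0 P = mxeval P 0.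
Proof.
by apply/matrixP => i j; rewrite !mxE /= /horner_eval horner_coef0.
Qed.

Lemma coefmxD m p k (P Q : 'M[{poly C}]_(m, p)) :
  coefmx k (P + Q) = coefmx k P + coefmx k Q.
Proof. exact: map_mxD. Qed.

Lemma coefmx_mull m p q k (A : 'M[C]_(m, p)) (P : 'M[{poly C}]_(p, q)) :
  coefmx k (mxcst A *m P) = A *m coefmx k P.
Proof.
apply/matrixP => i j; rewrite !mxE /= coef_sum; apply: eq_bigr => l _.
by rewrite !mxE coefCM.
Qed.

Lemma mxpolyP m p (P Q : 'M[{poly C}]_(m, p)) :
  (forall k, coefmx k P = coefmx k Q) -> P = Q.
Proof.
move=> PQ; apply/matrixP => i j; apply/polyP => k.
by have /matrixP/(_ i j) := PQ k; rewrite !mxE.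
Qed.

Lemma coefmx_cst0 m p (A : 'M[C]_(m, p)) k :
  (0 < k)%N -> coefmx k (mxcst A) = 0.
Proof.
by case: k => // k _; apply/matrixP => i j; rewrite !mxE /= coefC.
Qed.

(* All entries have [size] at most [N], i.e. degree less than [N]. *)
Definition mxsize_le m p (P : 'M[{poly C}]_(m, p)) (N : nat) :=
  forall k, (N <= k)%N -> coefmx k P = 0.

Lemma mxsize_le_ex m p (P : 'M[{poly C}]_(m, p)) : exists N, mxsize_le P N.
Proof.
exists (\max_(ij : 'I_m * 'I_p) size (P ij.1 ij.2)) => k Nk.
apply/matrixP => i j; rewrite !mxE /= nth_default //.
by apply: leq_trans Nk; exact: (leq_bigmax (i, j)).
Qed.

Lemma mxsize_leW m p (P : 'M[{poly C}]_(m, p)) N N' :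
  (N <= N')%N -> mxsize_le P N -> mxsize_le P N'.
Proof. by move=> NN' PN k /(leq_trans NN'); exact: PN. Qed.

Lemma mxsize_leS m p (P : 'M[{poly C}]_(m, p)) N :
  mxsize_le P N.+1 -> coefmx N P = 0 -> mxsize_le P N.
Proof. by move=> PN P0 k; rewrite leq_eqVlt => /predU1P [<-//|]; exact: PN. Qed.

Lemma mxsize_le1 m p (P : 'M[{poly C}]_(m, p)) :
  mxsize_le P 1 -> P = mxcst (mxeval P 0).
Proof.
move=> P1; apply: mxpolyP => -[|k]; last by rewrite P1 // coefmx_cst0.
by rewrite !coefmx0 mxeval_cst.
Qed.

Lemma mxsize_le_lin m p q N (A : 'M[C]_(m, p)) B (P Q : 'M[{poly C}]_(p, q)) :
  mxsize_le P N -> mxsize_le Q N -> mxsize_le (mxcst A *m P + mxcst B *m Q) N.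
Proof.
by move=> PN QN k Nk; rewrite coefmxD !coefmx_mull PN // QN // !mulmx0 addr0.
Qed.

Definition mxdivX m p (P : 'M[{poly C}]_(m, p)) : 'M[{poly C}]_(m, p) :=
  map_mx (drop_poly 1) P.

Lemma coefmx_divX m p k (P : 'M[{poly C}]_(m, p)) :
  coefmx k (mxdivX P) = coefmx k.+1 P.
Proof. by apply/matrixP => i j; rewrite !mxE /= coef_drop_poly addn1. Qed.

Lemma mxdivXK m p (P : 'M[{poly C}]_(m, p)) :
  mxeval P 0 = 0 -> 'X *: mxdivX P = P.
Proof.
move=> P0; apply: mxpolyP => -[|k]; last first.
  by rewrite -[RHS]coefmx_divX; apply/matrixP => i j; rewrite !mxE /= coefXM.
by rewrite !coefmx0 mxevalZ P0 hornerX scale0r.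
Qed.

(** For degree at most N this is the reciprocal polynomial z^N P(1/z), which turns the top
    coefficient into a value at 0. *)
Definition mxrev m p N (P : 'M[{poly C}]_(m, p)) : 'M[{poly C}]_(m, p) :=
  map_mx (fun q : {poly C} => \poly_(i < N.+1) q`_(N - i)) P.

Lemma mxeval_rev0 m p N (P : 'M[{poly C}]_(m, p)) :
  mxeval (mxrev N P) 0 = coefmx N P.
Proof.
by apply/matrixP => i j; rewrite !mxE /horner_eval horner_coef0 coef_poly subn0.
Qed.

Lemma mxeval_rev m p N (P : 'M[{poly C}]_(m, p)) w : w != 0 ->
  mxsize_le P N.+1 -> mxeval (mxrev N P) w = w ^+ N *: mxeval P w^-1.
Proof.
move=> w0 PN; apply/matrixP => i j; rewrite !mxE /horner_eval horner_poly.
rewrite (@horner_coef_wide _ N.+1); last first.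
  by apply/leq_sizeP => k Nk; have /matrixP/(_ i j) := PN k Nk; rewrite !mxE.
rewrite mulr_sumr (reindex_inj rev_ord_inj) /=; apply: eq_bigr => k _.
have kN : (k <= N)%N by rewrite -ltnS.
rewrite subSS subKn // mulrCA; congr (_ * _).
have -> : w ^+ N = w ^+ (N - k) * w ^+ k by rewrite -exprD subnK.
by rewrite exprVn mulfK // expf_neq0.
Qed.

End PolyMatrices.

Lemma eq_block_mxE (T : Type) m1 m2 n1 n2 (A A' : 'M[T]_(m1, n1))
    (B B' : 'M_(m1, n2)) (D D' : 'M_(m2, n1)) (E E' : 'M_(m2, n2)) :
  A = A' -> B = B' -> D = D' -> E = E' ->
  block_mx A B D E = block_mx A' B' D' E'.
Proof. by move=> -> -> -> ->. Qed.

(** * Conjugation by powers of Z *)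

Section Zconj.
Variables (R : realType) (n : nat).
Local Notation C := (R[i]).
Implicit Types (X : 'M[C]_(n + n)) (z : C) (j k : int).

(** This is z^(j/2) Z^j: the scalar drops out on conjugation, and no square root of z remains. *)
Definition Zdiag z j : 'M[C]_(n + n) := block_mx (z ^ j)%:M 0 0 1%:M.

Lemma ZdiagD z j k : z != 0 -> Zdiag z j *m Zdiag z k = Zdiag z (j + k).
Proof.
move=> z0; rewrite mulmx_block !mulmx0 !mul0mx !addr0 !add0r mulmx1.
by rewrite -scalar_mxM -expfzDr.
Qed.

Lemma Zdiag0 z : Zdiag z 0 = 1%:M.
Proof. by rewrite /Zdiag expr0z -scalar_mx_block. Qed.

Lemma ZconjE z j X : z != 0 -> Zconj z j X = Zdiag z j *m X *m Zdiag z (- j).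
Proof.
move=> z0; rewrite /Zconj /Zdiag -[X in _ = _ *m X *m _]submxK.
rewrite mulmx_block !mul0mx !addr0 !add0r !mul1mx !mul_scalar_mx.
rewrite mulmx_block !mulmx0 !addr0 !add0r !mulmx1 !mul_mx_scalar.
by rewrite scalerA -expfzDr // addNr expr0z scale1r.
Qed.

Lemma ZdiagNK z j X : z != 0 -> Zdiag z (- j) *m (Zdiag z j *m X) = X.
Proof. by move=> z0; rewrite mulmxA ZdiagD // addNr Zdiag0 mul1mx. Qed.

Lemma ZconjM z j X X' : z != 0 ->
  Zconj z j (X *m X') = Zconj z j X *m Zconj z j X'.
Proof. by move=> z0; rewrite !ZconjE // -!mulmxA ZdiagNK. Qed.

Lemma ZconjD z j k X : z != 0 -> Zconj z j (Zconj z k X) = Zconj z (j + k) X.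
Proof.
move=> z0; rewrite 3!(ZconjE _ _ z0) opprD [- j - k]addrC.
by rewrite -(ZdiagD j k z0) -(ZdiagD (- k) (- j) z0) !mulmxA.
Qed.

Lemma Zconj0 z X : Zconj z 0 X = X.
Proof. by rewrite /Zconj oppr0 expr0z !scale1r submxK. Qed.

Lemma Zconj1 z j : Zconj z j 1%:M = 1%:M :> 'M[C]_(n + n).
Proof.
rewrite /Zconj scalar_mx_block block_mxKul block_mxKur block_mxKdl block_mxKdr.
by rewrite !scaler0.
Qed.

Lemma Zconj_inj z j : z != 0 -> injective (@Zconj R n z j).
Proof.
move=> z0 X X' /(congr1 (Zconj z (- j))).
by rewrite !ZconjD // addNr !Zconj0.
Qed.

Lemma det_Zconj z j X : z != 0 -> \det (Zconj z j X) = \det X.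
Proof.
move=> z0; rewrite ZconjE // !det_mulmx mulrAC -det_mulmx ZdiagD // subrr.
by rewrite Zdiag0 det1 mul1r.
Qed.

Lemma Zconj_unitary (z : circle R) j X :
  (Zconj (val z) j X \is unitarymx) = (X \is unitarymx).
Proof.
have z0 := circle_neq0 z.
have Zu k : Zdiag (val z) k \is unitarymx.
  apply/unitarymxP.
  have -> : (Zdiag (val z) k)^t* = Zdiag (val z) (- k).
    rewrite adjmx_block !adjmx0 adjmx1 tr_scalar_mx map_scalar_mx /=.
    by rewrite rmorphXz /= ?unitfE // circle_conj exprz_inv.
  by rewrite (ZdiagD _ _ z0) subrr Zdiag0.
have h k (Y : 'M[C]_(n + n)) :
    Y \is unitarymx -> Zconj (val z) k Y \is unitarymx.
  move=> UY; rewrite (ZconjE _ _ z0); apply: mul_unitarymx (Zu _).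
  by apply: mul_unitarymx; [exact: Zu|exact: UY].
apply/idP/idP; last exact: h.
by move=> /(h (- j)); rewrite (ZconjD _ _ _ z0) addNr Zconj0.
Qed.

End Zconj.

(** * Unitary functions with B and C^* analytic *)

Section Causal.
Variables (R : realType) (n : nat) (alpha : bool -> bool).
Local Notation C := (R[i]).
Implicit Types (M : circle R -> 'M[C]_(n + n)) (a b c d : 'M[{poly C}]_n).

(** The class on which layer stripping operates. The polynomials are parameters, which keeps their
    coefficients and degrees at hand; the variable of [a] and [c] is 1/z, that of [b] and [d] is
    z. *)
Record causal a b c d M : Prop := Causal {
  causalE : forall z, M z = block_mx (mxeval a (val z)^-1) (mxeval b (val z))
                                     (mxeval c (val z)^-1) (mxeval d (val z));
  causal_unitary : forall z, M z \is unitarymx;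
  causal_ul : Ggroup (alpha false) (mxeval a 0);
  causal_dr : Ggroup (alpha true) (mxeval d 0) }.

Lemma causal_uniq a b c d a' b' c' d' M :
  causal a b c d M -> causal a' b' c' d' M -> b = b' /\ d = d'.
Proof.
move=> [MP _ _ _] [MQ _ _ _]; split; apply: mxeval_inj => z; move: (MP z);
  by rewrite MQ; move: (val z) => w /eq_block_mx [].
Qed.

(** Conjugation by Z multiplies B by z and C by 1/z, so the constant coefficients of the product
    involve only those of A and D. In particular [b'] and [d'] take the values F d(0) and H d(0) at
    0, whose quotient is F H^-1, and [Smx_recover] applies. *)
Lemma causal_cons (F : 'M[C]_n) a b c d M : contractive F -> causal a b c d M ->
  exists a' b' c' d',
   causal a' b' c' d' (fun z => Ymx alpha F *m Zconj (val z) 1 (M z)) /\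
   Smx alpha (mxeval b' 0 *m invmx (mxeval d' 0)) = Ymx alpha F.
Proof.
move=> /(YmxP alpha) [UY].
move: (Ymx alpha F) UY => Y; rewrite -[Y]submxK.
rewrite block_mxKul block_mxKur block_mxKdr.
move: (ulsubmx Y) (ursubmx Y) (dlsubmx Y) (drsubmx Y).
move=> E F1 G H UY eF GE GH; rewrite {}eF in UY *.
move=> [ME MU Ma Md].
(* In the first and third polynomial ['X] stands for 1/z, in the other two for z. *)
exists (mxcst E *m a + 'X *: (mxcst F *m c)),
  ('X *: (mxcst E *m b) + mxcst F *m d),
  (mxcst G *m a + 'X *: (mxcst H *m c)),
  ('X *: (mxcst G *m b) + mxcst H *m d).
split; first split.
- move=> z. rewrite ME. move: (val z) => w.
  rewrite /Zconj block_mxKul block_mxKur block_mxKdl block_mxKdr.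
  rewrite mulmx_block expr1z; apply: eq_block_mxE.
  + by rewrite mxevalD mxevalZ !mxeval_cstM hornerX scalemxAr.
  + by rewrite mxevalD mxevalZ !mxeval_cstM hornerX scalemxAr.
  + by rewrite mxevalD mxevalZ !mxeval_cstM hornerX scalemxAr.
  + by rewrite mxevalD mxevalZ !mxeval_cstM hornerX scalemxAr.
- move=> z /=; apply: mul_unitarymx; first exact: UY.
  by rewrite Zconj_unitary; exact: MU.
- rewrite mxevalD mxevalZ hornerX scale0r addr0 mxeval_cstM.
  exact: Ggroup_mul.
- rewrite mxevalD mxevalZ hornerX scale0r add0r mxeval_cstM.
  exact: Ggroup_mul.
rewrite !mxevalD !mxevalZ hornerX !scale0r !add0r !mxeval_cstM.
have uH := Ggroup_unit GH; have ud := Ggroup_unit Md.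
have uHd : H *m mxeval d 0 \in unitmx by rewrite unitmx_mul uH.
have -> : F *m mxeval d 0 *m invmx (H *m mxeval d 0) = F *m invmx H.
  apply: (can_inj (mulmxK uHd)).
  by rewrite mulmxKV // mulmxA mulmxKV.
have := @Smx_recover _ _ alpha (block_mx E F G H).
by rewrite block_mxKul block_mxKur block_mxKdr; exact.
Qed.

End Causal.

(** * Layer stripping *)

Section Strip.
Variables (R : realType) (n : nat) (alpha : bool -> bool).
Local Notation C := (R[i]).
Implicit Types (M : circle R -> 'M[C]_(n + n)) (a b c d : 'M[{poly C}]_n).

(** On the circle A^* and C^* are polynomials in z, so A^* B + C^* D = 0 becomes a polynomial
    identity, ready for evaluation at 0. *)
Lemma causal_orth a b c d M :
  causal alpha a b c d M -> mxadj a *m b + mxadj c *m d = 0.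
Proof.
move=> [ME MU _ _]; apply: mxeval_inj => z; move: (MU z) (circle_conj z).
rewrite ME; move: (val z) => w /unitary_block_adj [_ h _ _] wV.
by rewrite mxevalD !mxevalM !mxeval_adj wV mxeval0.
Qed.

Lemma causal_norm a b c d M (z : circle R) : causal alpha a b c d M ->
  (mxeval b (val z))^t* *m mxeval b (val z) +
  (mxeval d (val z))^t* *m mxeval d (val z) = 1%:M.
Proof.
move=> [ME MU _ _]; move: (MU z); rewrite ME; move: (val z) => w.
by case/unitary_block_adj.
Qed.

(* Multiplying [b^* b + d^* d = 1] by [z^-N] and rewriting it in the variable
   [1/z] gives an identity between polynomials, evaluated here at [0]. *)
Lemma top_coef_orth N b d :
  (forall z : circle R, (mxeval b (val z))^t* *m mxeval b (val z) +
    (mxeval d (val z))^t* *m mxeval d (val z) = 1%:M) ->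
  mxsize_le b N.+1 -> mxsize_le d N.+1 -> (0 < N)%N ->
  (mxeval b 0)^t* *m coefmx N b + (mxeval d 0)^t* *m coefmx N d = 0.
Proof.
move=> bd bN dN N0.
have E : mxadj b *m mxrev N b + mxadj d *m mxrev N d = 'X^N *: mxcst 1%:M.
  apply: mxeval_inj => z.
  move: (bd (circleV z)) (circle_conj z) (circle_neq0 z) => /=.
  move: (val z) => w h wV w0.
  rewrite mxevalD !mxevalM !mxeval_adj wV !mxeval_rev // -!scalemxAr.
  by rewrite -scalerDr h mxevalZ hornerXn mxeval_cst.
have := congr1 (fun P => mxeval P 0) E.
rewrite mxevalD !mxevalM !mxeval_adj rmorph0 !mxeval_rev0 => ->.
by rewrite mxevalZ hornerXn expr0n (gtn_eqF N0) scale0r.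
Qed.

Lemma mxsize_le0 m p N : mxsize_le (0 : 'M[{poly C}]_(m, p)) N.
Proof. by move=> k _; apply/matrixP => i j; rewrite !mxE /= coef0. Qed.

(** With second summand 0, [top_coef_orth] says a(0)^* a_N = 0, so a_N vanishes and the degree
    descends to 0. *)
Lemma unitary_poly_cst a :
  (forall z : circle R, (mxeval a (val z))^t* *m mxeval a (val z) = 1%:M) ->
  mxeval a 0 \in unitmx -> a = mxcst (mxeval a 0).
Proof.
move=> aU ua; apply: mxsize_le1; have [N] := mxsize_le_ex a.
elim: N => [|[|N] IH] aN //; first exact: mxsize_leW aN.
have uaa : (mxeval a 0)^t* \in unitmx by rewrite unitmx_adj.
have := @top_coef_orth N.+1 a 0 _ aN (@mxsize_le0 _ _ _) isT.
rewrite !mxeval0 adjmx0 mul0mx addr0 => h.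
apply/IH/(mxsize_leS aN)/(can_inj (mulKmx uaa)); rewrite mulmx0; apply: h => z.
by rewrite mxeval0 mulmx0 addr0; exact: aU.
Qed.

(** D(0) is unitary with triangular shape and positive diagonal, hence 1. Then A is unitary on the
    circle and C = 0; [unitary_poly_cst] makes A constant, and A = 1 follows as for D. *)
Lemma causal_cst a b c d M : causal alpha a b c d M -> b = 0 ->
  mxsize_le d 1 -> forall z, M z = 1%:M.
Proof.
move=> cM b0 d1; have [ME MU Ma Md] := cM.
have dc := mxsize_le1 d1.
pose z0 := circle_point R 0.
have d0 : mxeval d 0 = 1%:M.
  apply: Ggroup_unitary Md _; apply: mulmx1C.
  have := causal_norm z0 cM; rewrite b0 dc !mxeval0 mulmx0 add0r.
  by rewrite !mxeval_cst.
have hz (z : circle R) :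
    mxeval a (val z)^-1 *m (mxeval a (val z)^-1)^t* = 1%:M /\
    mxeval c (val z)^-1 = 0.
  have := MU z; rewrite ME b0 dc d0.
  move: (val z) => w /unitary_block [h1 _ h3 _].
  move: h1 h3; rewrite !mxeval0 !mxeval_cst mul0mx addr0 adjmx0 mulmx0 addr0.
  move=> h1 h3; split => //; have [ua _] := mulmx1_unit h1.
  have uaa : (mxeval a w^-1)^t* \in unitmx by rewrite unitmx_adj.
  by apply: (can_inj (mulmxK uaa)); rewrite h3 mul0mx.
have ac : a = mxcst (mxeval a 0).
  apply: unitary_poly_cst; last exact: Ggroup_unit Ma.
  (* In [hz] the polynomial [a] is evaluated at 1/z, so its value at z is found at the inverse
     point. *)
  move=> z; have [/mulmx1C + _] := hz (circleV z).
  by rewrite /= invrK.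
have a0 : mxeval a 0 = 1%:M.
  apply: Ggroup_unitary Ma _.
  by have [+ _] := hz z0; rewrite ac !mxeval_cst.
move=> z; rewrite ME (hz z).2 b0 ac a0 dc d0 !mxeval_cst mxeval0.
by rewrite -scalar_mx_block.
Qed.

(** As S is unitary, S^* serves as its inverse. The bound for B always drops, through the division
    by z; that for D drops when N > 0, where [top_coef_orth] is available. *)
Lemma causal_strip a b c d M N : causal alpha a b c d M ->
  mxsize_le b N.+1 -> mxsize_le d N.+1 ->
  exists a' b' c' d',
    [/\ causal alpha a' b' c' d' (fun z => Zconj (val z) (-1)
          ((Smx alpha (mxeval b 0 *m invmx (mxeval d 0)))^t* *m M z)),
        mxsize_le b' N, mxsize_le d' N.+1 & (0 < N)%N -> mxsize_le d' N].
Proof.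
move=> cM bN dN; have [ME MU Ma Md] := cM.
set K := _ *m invmx _.
have ud := Ggroup_unit Md.
have Kd : K *m mxeval d 0 = mxeval b 0 by rewrite mulmxKV.
have [US GE GH] := Smx_blocks alpha K.
move: US GE GH; rewrite /Smx block_mxKul block_mxKdr.
move: (sqrtmx (alpha false) _) (sqrtmx (alpha true) _) => E H US GE GH.
clearbody K.
have uE := Ggroup_unit GE; have uH := Ggroup_unit GH.
have [h1 _ _ h4] := unitary_block_adj US.
have SE : (block_mx E (K *m H) (- (K^t* *m E)) H)^t* =
    block_mx (E^t*) (- (E^t* *m K)) (H^t* *m K^t*) (H^t*).
  by rewrite adjmx_block adjmxN !adjmxM trmxCK.
(* The normalized block columns of S give this identity and the next. They turn the new constant
   coefficients of A and D into E^-1 A(oo) and H^-1 D(0), which stay in the triangular groups. *)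
have EK : E^t* + E^t* *m K *m K^t* = invmx E.
  rewrite -[RHS]mul1mx -h1 adjmxN adjmxM trmxCK mulNmx mulmxN opprK.
  by rewrite !mulmxA -!mulmxDl mulmxK.
have HK : H^t* *m K^t* *m K + H^t* = invmx H.
  by rewrite -[RHS]mul1mx -h4 adjmxM !mulmxA -!mulmxDl mulmxK.
(* This is the constant coefficient of A^* B + C^* D = 0 after B(0) = K D(0) is inserted and D(0)
   cancelled. It makes the new lower left block divisible by 1/z. *)
have Ka : mxeval c 0 = - (K^t* *m mxeval a 0).
  have /(congr1 (fun P => mxeval P 0)) := causal_orth cM.
  rewrite mxevalD !mxevalM !mxeval_adj rmorph0 mxeval0 -Kd mulmxA -mulmxDl => h.
  have {}h : (mxeval a 0)^t* *m K + (mxeval c 0)^t* = 0.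
    by rewrite -[LHS](mulmxK ud) h mul0mx.
  rewrite -[LHS]trmxCK -[(mxeval c 0)^t*](addKr ((mxeval a 0)^t* *m K)) h addr0.
  by rewrite adjmxN adjmxM trmxCK.
(* These are the blocks of S^* M. Since [b2] and [c2] vanish at 0, dividing them by their variables,
   z and 1/z, accounts for the conjugation by Z^-1. *)
pose a' := mxcst (E^t*) *m a + mxcst (- (E^t* *m K)) *m c.
pose b2 := mxcst (E^t*) *m b + mxcst (- (E^t* *m K)) *m d.
pose c2 := mxcst (H^t* *m K^t*) *m a + mxcst (H^t*) *m c.
pose d' := mxcst (H^t* *m K^t*) *m b + mxcst (H^t*) *m d.
have bX : 'X *: mxdivX b2 = b2.
  apply: mxdivXK; rewrite mxevalD !mxeval_cstM -Kd mulNmx -mulmxA.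
  by rewrite subrr.
have cX : 'X *: mxdivX c2 = c2.
  apply: mxdivXK; rewrite mxevalD !mxeval_cstM Ka mulmxN -!mulmxA.
  by rewrite subrr.
exists a', (mxdivX b2), (mxdivX c2), d'; split; first split.
- move=> z; rewrite ME SE; move: (val z) (circle_neq0 z) => w w0.
  rewrite mulmx_block /Zconj block_mxKul block_mxKur block_mxKdl block_mxKdr.
  rewrite opprK expr1z exprN1; apply: eq_block_mxE.
  + by rewrite mxevalD !mxeval_cstM.
  + rewrite -(mxeval_cstM (E^t*)) -mxeval_cstM -mxevalD -/b2 -{1}bX mxevalZ.
    by rewrite hornerX scalerA mulVf // scale1r.
  + rewrite -(mxeval_cstM (H^t*)) -mxeval_cstM -mxevalD -/c2 -{1}cX mxevalZ.
    by rewrite hornerX scalerA divff // scale1r.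
  by rewrite mxevalD !mxeval_cstM.
- move=> z; rewrite Zconj_unitary; apply: mul_unitarymx; last exact: MU.
  by rewrite trmxC_unitary.
- rewrite mxevalD !mxeval_cstM Ka mulmxN mulNmx opprK mulmxA -mulmxDl EK.
  exact: Ggroup_mul (Ggroup_inv GE) Ma.
- rewrite mxevalD !mxeval_cstM -Kd !mulmxA -mulmxDl HK.
  exact: Ggroup_mul (Ggroup_inv GH) Md.
- move=> k Nk; rewrite coefmx_divX; apply: mxsize_le_lin bN dN _ _.
  by rewrite ltnS.
- exact: mxsize_le_lin bN dN.
(* With B(0) = K D(0), [top_coef_orth] reads D(0)^* (K^* b_N + d_N) = 0, while the coefficient of
   z^N in [d'] is H^* (K^* b_N + d_N). *)
move=> N0; apply: mxsize_leS; first exact: mxsize_le_lin bN dN.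
have := top_coef_orth (fun z => causal_norm z cM) bN dN N0.
have uda : (mxeval d 0)^t* \in unitmx by rewrite unitmx_adj.
rewrite -Kd adjmxM -mulmxA -mulmxDr => h.
rewrite coefmxD !coefmx_mull -mulmxA -mulmxDr.
have -> : K^t* *m coefmx N b + coefmx N d = 0; last by rewrite mulmx0.
by apply: (can_inj (mulKmx uda)); rewrite h mulmx0.
Qed.
End Strip.

(** * Finite products of layers *)

Section Layers.
Variables (R : realType) (n : nat) (alpha : bool -> bool).
Local Notation C := (R[i]).
Implicit Types (M : circle R -> 'M[C]_(n + n)) (f g : nat -> 'M[C]_n).
Implicit Types (F : int -> 'M[C]_n).

(** The ordered product nested as in Horner's scheme: each further level adds one conjugation by Z,
    so the factor of index k is conjugated by Z^k. The indices run from 0 to N - 1. *)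
Fixpoint layers f N (w : C) : 'M[C]_(n + n) :=
  if N is N'.+1 then
    Ymx alpha (f 0) *m Zconj w 1 (layers (fun k => f k.+1) N' w)
  else 1%:M.

Lemma causal_id : causal alpha (mxcst 1%:M) 0 0 (mxcst 1%:M)
  (fun _ => 1%:M : 'M[C]_(n + n)).
Proof.
split.
- move=> z; move: (val z) => w.
  by rewrite !mxeval_cst !mxeval0 -scalar_mx_block.
- by move=> z; apply/unitarymxP; rewrite adjmx1 mulmx1.
- by rewrite mxeval_cst; exact: Ggroup1.
- by rewrite mxeval_cst; exact: Ggroup1.
Qed.

Lemma layers_causal f N : (forall k, contractive (f k)) ->
  exists a b c d, causal alpha a b c d (fun z => layers f N (val z)).
Proof.
elim: N f => [|N IH] f fC.
  by exists (mxcst 1%:M), 0, 0, (mxcst 1%:M); exact: causal_id.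
have [a [b [c [d cM]]]] := IH (fun k => f k.+1) (fun k => fC k.+1).
have [a' [b' [c' [d' [cM' _]]]]] := causal_cons (fC 0) cM.
by exists a', b', c', d'.
Qed.

(** By [causal_cons] both first factors are [Smx] of the same quotient B(0) D(0)^-1. Cancelling them
    and undoing the conjugation identifies the remainders. *)
Lemma layer_uniq (X Y : 'M[C]_n) a b c d M a' b' c' d' M' :
  contractive X -> contractive Y ->
  causal alpha a b c d M -> causal alpha a' b' c' d' M' ->
  (forall z, Ymx alpha X *m Zconj (val z) 1 (M z) =
             Ymx alpha Y *m Zconj (val z) 1 (M' z)) ->
  X = Y /\ forall z, M z = M' z.
Proof.
move=> cX cY cM cM' XY.
have [a1 [b1 [c1 [d1 [cX1 SX]]]]] := causal_cons cX cM.
have [a2 [b2 [c2 [d2 [cY2 SY]]]]] := causal_cons cY cM'.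
have {}cY2 : causal alpha a2 b2 c2 d2
    (fun z => Ymx alpha X *m Zconj (val z) 1 (M z)).
  by have -> : (fun z => Ymx alpha X *m Zconj (val z) 1 (M z)) =
    (fun z => Ymx alpha Y *m Zconj (val z) 1 (M' z)) by apply/funext.
have [eb ed] := causal_uniq cX1 cY2.
have YXY : Ymx alpha X = Ymx alpha Y by rewrite -SX -SY eb ed.
have [UX uX _ _] := YmxP alpha cX; have [_ uY _ _] := YmxP alpha cY.
split; first by rewrite -uX YXY uY.
move=> z; have := XY z; rewrite -YXY => /(can_inj (mulKmx (unitarymx_unit UX))).
exact: (Zconj_inj (circle_neq0 z)).
Qed.

Lemma layers_inj f g N :
  (forall k, contractive (f k)) -> (forall k, contractive (g k)) ->
  (forall z : circle R, layers f N (val z) = layers g N (val z)) ->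
  forall k, (k < N)%N -> f k = g k.
Proof.
elim: N f g => [//|N IH] f g fC gC fg.
have [a [b [c [d cf]]]] := layers_causal N (fun k => fC k.+1).
have [a' [b' [c' [d' cg]]]] := layers_causal N (fun k => gC k.+1).
have [fg0 fgS] := layer_uniq (fC 0) (gC 0) cf cg fg.
move=> [_|k]; first exact: fg0.
by rewrite ltnS; exact: (IH _ _ (fun k => fC k.+1) (fun k => gC k.+1)).
Qed.

Lemma layersS0 f N w : f N = 0 -> layers f N.+1 w = layers f N w.
Proof.
elim: N f => [|N IH] f fN /=; first by rewrite fN Ymx0 Zconj1 mul1mx.
by rewrite -[in RHS]IH.
Qed.

(** Induction on the degree bound: each strip splits off one layer and lowers N, so degree at most N
    takes N + 1 layers. *)
Lemma causal_layers N a b c d M : causal alpha a b c d M ->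
  mxsize_le b N.+1 -> mxsize_le d N.+1 ->
  exists f, [/\ forall k, contractive (f k), forall k, (N < k)%N -> f k = 0 &
                forall z, M z = layers f N.+1 (val z)].
Proof.
elim: N a b c d M => [|N IH] a b c d M cM bN dN;
  have [a' [b' [c' [d' []]]]] := causal_strip cM bN dN;
  have [US GE GH] := Smx_blocks alpha (mxeval b 0 *m invmx (mxeval d 0));
  move: (Smx _ _) US GE GH => S US GE GH cM' b'N d'N d'N';
  have SF := Ymx_eq US GE GH;
  have cS := ursubmx_contractive US (Ggroup_unit GH);
  have ME (z : circle R) :
      M z = S *m Zconj (val z) 1 (Zconj (val z) (-1) (S^t* *m M z)) by
    rewrite (ZconjD _ _ _ (circle_neq0 z)) subrr Zconj0 mulmxA (unitarymxP US)
      mul1mx.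
(* At N = 0 one strip leaves B = 0 and D constant, so by [causal_cst] the remainder is 1. *)
- exists (fun k => if k is 0%N then ursubmx S else 0); split.
  + by case=> [|k]; [exact: cS|exact: contractive0].
  + by case=> [//|k _].
  move=> z; rewrite ME /= SF (causal_cst cM') //; apply: mxpolyP => k.
  by rewrite b'N //; apply: esym; exact: (@mxsize_le0 R n n 0 k).
have [f [fC f0 Mf]] := IH _ _ _ _ _ cM' b'N (d'N' isT).
exists (fun k => if k is k'.+1 then f k' else ursubmx S); split.
- by case=> [|k]; [exact: cS|exact: fC].
- by case=> [//|k]; rewrite ltnS; exact: f0.
by move=> z; rewrite ME Mf -[in LHS]SF.
Qed.

Lemma layers_big f N w : w != 0 -> layers f N w =
  \big[mulmx/1%:M]_(0 <= k < N) Zconj w k%:Z (Ymx alpha (f k)).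
Proof.
move=> w0; elim: N f => [|N IH] f; first by rewrite big_geq.
rewrite big_nat_recl //= Zconj0 IH; congr (_ *m _).
rewrite (big_morph (Zconj w 1) (id1 := 1%:M) (op1 := mulmx)) => [|X Y|].
- by apply: eq_bigr => k _; rewrite ZconjD // -intS.
- exact: ZconjM.
exact: Zconj1.
Qed.

(** Indices of the window outside the support contribute factors [Ymx 0], which are 1. *)
Lemma NLFT_layers F (m : int) N (z : circle R) :
  (forall j, F j != 0 -> m <= j < m + N%:Z) ->
  NLFT alpha F z = Zconj (val z) m (layers (fun k => F (m + k%:Z)) N (val z)).
Proof.
move=> Fm; have z0 := circle_neq0 z.
rewrite layers_big //.
rewrite (big_morph (Zconj (val z) m) (id1 := 1%:M) (op1 := mulmx));
  [|by move=> X Y; exact: ZconjM|exact: Zconj1].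
pose s := [seq m + k%:Z | k <- iota 0 N].
have finF : finite_set (support_seq F).
  apply: (sub_finite_set (B := [set` s])); last exact: finite_seq.
  move=> j /= /Fm /andP [mj jm]; apply/mapP; exists `|j - m|%N; last by lia.
  by rewrite mem_iota; lia.
rewrite /NLFT.
(* Both lists are strictly increasing and have the same elements. *)
have -> : sort <=%R (enum_fset (fset_set (support_seq F))) =
    [seq j <- s | F j != 0].
  apply: (irr_sorted_eq lt_trans ltxx).
  - by rewrite sort_lt_sorted fset_uniq.
  - apply: sorted_filter; first exact: lt_trans.
    rewrite /s sorted_map; apply: sub_sorted (iota_ltn_sorted 0 N) => j k /= jk.
    by rewrite ltrD2l ltz_nat.
  move=> j; rewrite mem_sort mem_filter -[LHS]/(j \in fset_set (support_seq F)).
  rewrite in_fset_set //.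
  apply/idP/andP => [/set_mem Fj|[Fj _]]; last exact: mem_set.
  split=> //; apply/mapP; move: Fj => /Fm mj.
  by exists `|j - m|%N; [rewrite mem_iota|]; lia.
have -> : \big[mulmx/1%:M]_(j <- [seq j <- s | F j != 0])
      Zconj (val z) j (Ymx alpha (F j)) =
    \big[mulmx/1%:M]_(j <- s) Zconj (val z) j (Ymx alpha (F j)).
  rewrite big_filter; elim: (s) => [|j s' IH]; first by rewrite !big_nil.
  rewrite !big_cons IH; case: eqP => //= ->.
  by rewrite Ymx0 Zconj1 mul1mx.
rewrite big_map -/(index_iota 0 N) /index_iota subn0.
by apply: eq_bigr => k _; rewrite ZconjD.
Qed.
End Layers.

(** * The nonlinear Fourier transform *)

Lemma ursubmxZ (T : pzRingType) m n (c : T) (X : 'M[T]_(m + n)) :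
  ursubmx (c *: X) = c *: ursubmx X.
Proof. by apply/matrixP => i j; rewrite !mxE. Qed.

Lemma dlsubmxZ (T : pzRingType) m n (c : T) (X : 'M[T]_(m + n)) :
  dlsubmx (c *: X) = c *: dlsubmx X.
Proof. by apply/matrixP => i j; rewrite !mxE. Qed.

(** * Laurent polynomial matrix functions *)

Section Laurent.
Variables (R : realType).
Local Notation C := (R[i]).

Lemma laurent_mulmx m (M M' : circle R -> 'M[C]_m) :
  laurent_poly M -> laurent_poly M' -> laurent_poly (fun z => M z *m M' z).
Proof.
move=> [N [P MP]] [N' [P' MP']]; exists (N + N')%N, (P *m P') => z.
rewrite MP MP'; move: (val z) => w.
by rewrite mxevalM -scalemxAl -scalemxAr scalerA exprD invfM.
Qed.

Lemma laurent_1 m : laurent_poly (fun _ : circle R => 1%:M : 'M[C]_m).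
Proof.
exists 0%N, (mxcst 1%:M) => z; move: (val z) => w.
by rewrite expr0 invr1 scale1r mxeval_cst.
Qed.

Lemma laurent_Zconj n (X : 'M[C]_(n + n)) (j : int) :
  laurent_poly (fun z : circle R => Zconj (val z) j X).
Proof.
pose N := `|j|%N.
(* Multiplication by z^|j| turns z^j and z^-j into powers with the nonnegative exponents |j| + j and
   |j| - j. *)
exists N, (block_mx ('X^N *: mxcst (ulsubmx X))
                    ('X^`|N%:Z + j| *: mxcst (ursubmx X))
                    ('X^`|N%:Z - j| *: mxcst (dlsubmx X))
                    ('X^N *: mxcst (drsubmx X))) => z.
move: (val z) (circle_neq0 z) => w w0.
rewrite {1}/mxeval map_block_mx -!/(mxeval _ _) !mxevalZ !hornerXn !mxeval_cst.
rewrite scale_block_mx !scalerA mulVf ?expf_neq0 // !scale1r.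
have wk (k : int) : 0 <= N%:Z + k -> w ^- N * w ^+ `|N%:Z + k| = w ^ k.
  move=> k0; rewrite exprnN exprnP -expfzDr //; congr (w ^ _).
  by rewrite gez0_abs //; lia.
by rewrite !wk //; lia.
Qed.

End Laurent.

(** * Bijectivity and correctness of the algorithm *)

Section Bijection.
Variables (R : realType) (n : nat) (alpha : bool -> bool).
Local Notation C := (R[i]).
Implicit Types (M : circle R -> 'M[C]_(n + n)) (f g : nat -> 'M[C]_n).
Implicit Types (F G : int -> 'M[C]_n).

Lemma support_bound F : finite_set (support_seq F) ->
  exists B : nat, forall j, F j != 0 -> (`|j| <= B)%N.
Proof.
move=> finF; exists (\max_(j <- fset_set (support_seq F)) `|j|%N) => j Fj.
apply: leq_bigmax_seq => //.
by rewrite in_fset_set //; exact: mem_set.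
Qed.

(** The window from -B to B has 2B + 1 places. *)
Lemma NLFT_layers_bound F (B : nat) (z : circle R) :
  (forall j, F j != 0 -> (`|j| <= B)%N) ->
  NLFT alpha F z = Zconj (val z) (- B%:Z)
    (layers alpha (fun k => F (- B%:Z + k%:Z)) (B + B).+1 (val z)).
Proof. by move=> FB; apply: NLFT_layers => j /FB; lia. Qed.

(** On a window containing both supports the two transforms are equally shifted layer products,
    which [layers_inj] compares; outside it both sequences vanish. *)
Lemma NLFT_inj F G : fin_contractive F -> fin_contractive G ->
  NLFT alpha F = NLFT alpha G -> F = G.
Proof.
move=> [/support_bound [BF hF] cF] [/support_bound [BG hG] cG] FG.
pose B := maxn BF BG.
have {}hF j : F j != 0 -> (`|j| <= B)%N by move/hF; lia.
have {}hG j : G j != 0 -> (`|j| <= B)%N by move/hG; lia.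
have e : forall k, (k < (B + B).+1)%N -> F (- B%:Z + k%:Z) = G (- B%:Z + k%:Z).
  apply: (@layers_inj _ _ alpha (fun k => F (- B%:Z + k%:Z))
    (fun k => G (- B%:Z + k%:Z))) => [k|k|z]; [exact: cF|exact: cG|].
  have := congr1 (fun M => M z) FG.
  rewrite (NLFT_layers_bound z hF) (NLFT_layers_bound z hG).
  exact: (Zconj_inj (circle_neq0 z)).
apply/funext => j; have [jB|Bj] := leqP `|j|%N B.
  have -> : j = - B%:Z + (absz (j + B%:Z))%:Z by lia.
  by apply: e; lia.
have Fj : F j = 0 by apply/eqP/negPn/negP => /hF; rewrite leqNgt Bj.
have Gj : G j = 0 by apply/eqP/negPn/negP => /hG; rewrite leqNgt Bj.
by rewrite Fj Gj.
Qed.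

Lemma NLFT_laurent F : laurent_poly (NLFT alpha F).
Proof.
rewrite /NLFT; elim: (sort _ _) => [|j s IH].
  have -> : (fun z : circle R => \big[mulmx/1%:M]_(j <- [::])
    Zconj (val z) j (Ymx alpha (F j))) = (fun _ => 1%:M).
    by apply/funext => z; rewrite big_nil.
  exact: laurent_1.
have -> : (fun z : circle R => \big[mulmx/1%:M]_(j <- j :: s)
    Zconj (val z) j (Ymx alpha (F j))) =
  (fun z => Zconj (val z) j (Ymx alpha (F j)) *m
    \big[mulmx/1%:M]_(j <- s) Zconj (val z) j (Ymx alpha (F j))).
  by apply/funext => z; rewrite big_cons.
by apply: laurent_mulmx IH; exact: laurent_Zconj.
Qed.

Lemma det_NLFT F z : (forall j, contractive (F j)) -> \det (NLFT alpha F z) = 1.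
Proof.
move=> cF; rewrite /NLFT; elim: (sort _ _) => [|j s IH].
  by rewrite big_nil det1.
rewrite big_cons det_mulmx IH mulr1 (det_Zconj _ _ (circle_neq0 z)).
exact: det_Ymx.
Qed.

(** Conjugation leaves diagonal blocks alone, so the polynomials for A and D can be taken from the
    layer product before its shift. *)
Lemma NLFT_image_SU F : fin_contractive F ->
  @NLFT_image R n alpha (@SUgroup R (n + n)) (NLFT alpha F).
Proof.
move=> [/support_bound [B FB] cF].
have [a [b [c [d [ME MU Ma Md]]]]] :=
  layers_causal alpha (B + B).+1 (fun k => cF (- B%:Z + k%:Z)).
have NE z := NLFT_layers_bound z FB.
split.
- exact: NLFT_laurent.
- move=> z; split; last exact: det_NLFT.
  by rewrite NE Zconj_unitary; exact: MU.
- exists a => // z; rewrite NE ME; move: (val z) => w.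
  by rewrite /Zconj !block_mxKul.
exists d => // z; rewrite NE ME; move: (val z) => w.
by rewrite /Zconj !block_mxKdr.
Qed.

Definition shift_seq (m : int) f : int -> 'M[C]_n :=
  fun j => if m <= j then f `|j - m|%N else 0.

Lemma shift_seq_fin (m : int) f N : (forall k, contractive (f k)) ->
  (forall k, (N <= k)%N -> f k = 0) -> fin_contractive (shift_seq m f) /\
  forall z : circle R, NLFT alpha (shift_seq m f) z =
    Zconj (val z) m (layers alpha f N (val z)).
Proof.
move=> cf f0.
have supp j : shift_seq m f j != 0 -> m <= j < m + N%:Z.
  rewrite /shift_seq; case: (leP m j) => mj /=; last by rewrite eqxx.
  by have [/f0 ->|] := leqP N `|j - m|%N; [rewrite eqxx|lia].
split; first split.
- apply: (sub_finite_set (B := [set` [seq m + k%:Z | k <- iota 0 N]]));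
    last exact: finite_seq.
  move=> j /= /supp mj; apply/mapP; exists `|j - m|%N; last by lia.
  by rewrite mem_iota; lia.
- move=> j; rewrite /shift_seq.
  by case: ifP => _; [exact: cf|exact: contractive0].
move=> z; rewrite (NLFT_layers alpha z supp); congr Zconj; congr layers.
apply/funext => k.
rewrite /shift_seq lerDl /= (_ : absz (m + k%:Z - m)%R = k) //.
by lia.
Qed.

(** Conjugation by a high power Z^k makes B a polynomial in z and C one in 1/z; the sequence found
    there is then shifted back by k. *)
Lemma NLFT_surj M : @NLFT_image R n alpha (@Ugroup R (n + n)) M ->
  exists2 F, fin_contractive F & NLFT alpha F = M.
Proof.
move=> [[N [P MP]] MU [a Ma a0] [d Md d0]].
(* Let M = z^-N P. With k = N + S, z^k B is z^S times a block of P, and z^-k C is z^-(k+N) times a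
   block of degree at most k + N, that is, its reversal evaluated at 1/z. *)
have [S PS] := mxsize_le_ex (dlsubmx P); pose k := (N + S)%N.
have PkN : mxsize_le (dlsubmx P) (k + N).+1.
  by apply: mxsize_leW PS; rewrite /k; lia.
have cM : causal alpha a ('X^S *: ursubmx P) (mxrev (k + N) (dlsubmx P)) d
    (fun z => Zconj (val z) k%:Z (M z)).
  split; [|by move=> z; rewrite Zconj_unitary; exact: MU|exact: a0|exact: d0].
  move=> z.
  have := Ma z; have := Md z; have := MP z; move: (circle_neq0 z).
  rewrite /Zconj; move: (val z) (M z) => w X w0 XP -> ->.
  have w0' : w^-1 != 0 by rewrite invr_eq0.
  rewrite (mxeval_rev w0' PkN) invrK; apply: eq_block_mxE => //.
    rewrite XP ursubmxZ mxevalZ hornerXn scalerA.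
    have -> : mxeval (ursubmx P) w = ursubmx (mxeval P w).
      by apply/matrixP => i j; rewrite !mxE.
    congr (_ *: _); rewrite /k -exprnP exprD mulrAC mulfV ?mul1r //.
    by rewrite expf_neq0.
  rewrite XP dlsubmxZ scalerA.
  have -> : mxeval (dlsubmx P) w = dlsubmx (mxeval P w).
    by apply/matrixP => i j; rewrite !mxE.
  by congr (_ *: _); rewrite exprVn exprD invfM -exprnN.
have [Nb bN] := mxsize_le_ex ('X^S *: ursubmx P).
have [Nd dN] := mxsize_le_ex d.
pose L := maxn Nb Nd.
have [||f [cf f0 Mf]] := causal_layers (N := L) cM.
- by apply: mxsize_leW bN; rewrite /L; lia.
- by apply: mxsize_leW dN; rewrite /L; lia.
have [finF FE] := shift_seq_fin (- k%:Z) cf f0.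
exists (shift_seq (- k%:Z) f) => //; apply/funext => z.
by rewrite FE -Mf (ZconjD _ _ _ (circle_neq0 z)) addNr Zconj0.
Qed.

Lemma analytic_causal M : @NLFT_image R n alpha (@Ugroup R (n + n)) M ->
  B_Cstar_analytic M -> exists a b c d, causal alpha a b c d M.
Proof.
move=> [_ MU [a Ma a0] [d Md d0]] [[b Mb] [c Mc]]; exists a, b, c, d.
split => // z; rewrite -[LHS]submxK.
apply: eq_block_mxE; [exact: Ma|exact: Mb|exact: Mc|exact: Md].
Qed.

(** Every step is deterministic: the values on the circle determine the polynomials B and D, hence
    the layer and the next function. *)
Lemma layer_stripping_uniq M F G :
  layer_stripping_output alpha M F -> layer_stripping_output alpha M G -> F = G.
Proof.
move=> [Ms [M0 F0 Fstep]] [Ms' [M0' G0 Gstep]].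
have eq_step j : Ms j = Ms' j -> F j%:Z = G j%:Z /\ Ms j.+1 = Ms' j.+1.
  move=> MM; have [B [D [BE DE _ [FE ME]]]] := Fstep j.
  have [B' [D' [BE' DE' _ [GE ME']]]] := Gstep j.
  have eB : B = B' by apply: mxeval_inj => z; rewrite -BE -BE' MM.
  have eD : D = D' by apply: mxeval_inj => z; rewrite -DE -DE' MM.
  move: GE ME'; rewrite -eB -eD; move: (Smx _ _) FE ME => S FE ME GE ME'.
  split; first exact: etrans FE (esym GE).
  by apply/funext => z; rewrite ME ME' MM.
have MM j : Ms j = Ms' j by elim: j => [|j /eq_step []//]; rewrite M0 M0'.
apply/funext => -[j|j]; last by rewrite F0 // G0.
by have [] := eq_step j (MM j).
Qed.

Lemma layer_stripping_layers f N M : (forall k, contractive (f k)) ->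
  (forall k, (N <= k)%N -> f k = 0) ->
  (forall z, M z = layers alpha f N (val z)) ->
  layer_stripping_output alpha M (shift_seq 0 f).
Proof.
move=> cf f0 Mf.
(* The j-th iterate is the product over the tail of [f] starting at j, padded with zeros to N
   layers. *)
exists (fun j z => layers alpha (fun k => f (j + k)%N) N (val z)); split.
- by apply/funext => z; rewrite Mf.
- by move=> j j0; rewrite /shift_seq leNgt j0.
move=> j.
have [a [b [c [d cM]]]] := layers_causal alpha N (fun k => cf (j.+1 + k)%N).
have [a' [b' [c' [d' [cM' SY]]]]] := causal_cons (cf j) cM.
have step w : layers alpha (fun k => f (j + k)%N) N w =
    Ymx alpha (f j) *m Zconj w 1 (layers alpha (fun k => f (j.+1 + k)%N) N w).
  (* Since f vanishes at j + N, a trivial last layer can be appended before the first is split off,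
     which keeps the count at N. *)
  rewrite -layersS0 /=; last by rewrite f0 // leq_addl.
  rewrite addn0; congr (_ *m Zconj _ _ _); congr layers.
  by apply/funext => k; rewrite addSnnS.
have [ME MU Ma Md] := cM'.
have [UY uY _ _] := YmxP alpha (cf j).
exists b', d'; split.
- move=> z; rewrite step ME; move: (val z) => w; exact: block_mxKur.
- move=> z; rewrite step ME; move: (val z) => w; exact: block_mxKdr.
- exact: Ggroup_unit Md.
rewrite SY; split.
  by rewrite uY /shift_seq (_ : absz (j%:Z - 0)%R = j) //; lia.
move=> z; rewrite step (mulKmx (unitarymx_unit UY)).
by rewrite (ZconjD _ _ _ (circle_neq0 z)) addNr Zconj0.
Qed.

Lemma causal_stripping M a b c d : causal alpha a b c d M ->
  exists F, [/\ fin_contractive F, NLFT alpha F = M &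
                layer_stripping_output alpha M F].
Proof.
move=> cM; have [Nb bN] := mxsize_le_ex b; have [Nd dN] := mxsize_le_ex d.
pose L := maxn Nb Nd.
have [||f [cf f0 Mf]] := causal_layers (N := L) cM.
- by apply: mxsize_leW bN; rewrite /L; lia.
- by apply: mxsize_leW dN; rewrite /L; lia.
have [finF FE] := shift_seq_fin 0 cf f0.
exists (shift_seq 0 f); split=> //; last exact: layer_stripping_layers Mf.
by apply/funext => z; rewrite FE Zconj0 Mf.
Qed.
End Bijection.

Local Close Scope sesquilinear_scope.
Local Close Scope classical_set_scope.

Theorem lemma3p10 (R : realType) (n : nat) (n_ge1 : (1 <= n)%N)
  (alpha : bool -> bool) :
  [/\ set_bij (@fin_contractive R n)
              (@NLFT_image R n alpha (@Ugroup R (n + n)))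
              (@NLFT R n alpha),
      set_bij (@fin_contractive R n)
              (@NLFT_image R n alpha (@SUgroup R (n + n)))
              (@NLFT R n alpha) &
      forall M : circle R -> 'M[R[i]]_(n + n),
        @NLFT_image R n alpha (@Ugroup R (n + n)) M ->
        B_Cstar_analytic M ->
        forall F : int -> 'M[R[i]]_n,
          (fin_contractive F /\ NLFT alpha F = M) <->
          layer_stripping_output alpha M F].
Proof.
(* This lets one argument serve both bijections: [NLFT_surj] starts from the weaker condition,
   [NLFT_image_SU] delivers the stronger one. *)
have SU_U M : @NLFT_image R n alpha (@SUgroup R (n + n)) M ->
    @NLFT_image R n alpha (@Ugroup R (n + n)) M.
  by move=> [h1 h2 h3 h4]; split => // z; case: (h2 z).
have injF : set_inj (@fin_contractive R n) (@NLFT R n alpha).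
  by move=> F G /set_mem cF /set_mem cG; exact: NLFT_inj.
split.
- split; [|exact: injF|].
    by move=> F /(NLFT_image_SU alpha) /SU_U.
  by move=> M /NLFT_surj [F cF <-]; exists F.
- split; [|exact: injF|].
    by move=> F /(NLFT_image_SU alpha).
  by move=> M /SU_U /NLFT_surj [F cF <-]; exists F.
move=> M IM anM F.
have [a [b [c [d cM]]]] := analytic_causal IM anM.
(* [G] is at once a preimage and an output; as both are unique, either side of the equivalence
   forces F = G. *)
have [G [cG GM outG]] := causal_stripping cM.
split=> [[cF FM]|outF].
  by rewrite (NLFT_inj cF cG (alpha := alpha)) // FM GM.
by rewrite (layer_stripping_uniq outF outG).
Qed.
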